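(* Let $G$ be a finitely generated group acting by isometries on a $\delta$-hyperbolic space $X$. Suppose that the action is acylindrical and non-elementary. Assume that there exists a constant $M$ such that for any finite generating set $S$ of $G$, the set $S^M$ contains an element that is hyperbolic on $X$. Assume that $G$ is equationally Noetherian. Then $\xi(G)$ is a well-ordered set.
   Context: A $\delta$-hyperbolic space is a geodesic metric space that is $\delta$-hyperbolic in the sense of Gromov; distance is written $d$ or $|x-y|$. Growth. Generating sets are always assumed symmetric: $S=S^{-1}$. For a finite generating set $S$ of a finitely generated group $G$, $S^n=B_n(G,S)$ denotes the set of elements of $G$ of word length at most $n$ with respect to $S$, and $e(G,S)=\lim_{n\to\infty}|B_n(G,S)|^{1/n}$. Put $\xi(G)=\{e(G,S) : S \text{ a finite generating set of } G\}\subset\mathbb{R}$. Well-ordered refers to the usual order of $\mathbb{R}$. Actions. The action of $G$ on $X$ is acylindrical if for every $\epsilon>0$ there exist $R=R(\epsilon)>0$ and $N=N(\epsilon)>0$ such that for all $x,y\in X$ with $d(x,y)\ge R$, the set $\{g\in G : d(x,g(x))\le\epsilon,\ d(y,g(y))\le\epsilon\}$ contains at most $N$ elements. The action is elementary if the limit set of $G$ in the Gromov boundary $\partial X$ has at most two points, and non-elementary otherwise. An isometry $g$ of $X$ is hyperbolic if there are $x\in X$ and $C>0$ with $|x-g^n(x)|>Cn$ for all $n>0$. Equationally Noetherian. For a subset $S$ of the free group $F(x_1,\dots,x_\ell)$ let $V_G(S)=\{(g_1,\dots,g_\ell)\in G^\ell : s(g_1,\dots,g_\ell)=1 \text{ for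 all } s\in S\}$. $G$ is equationally Noetherian if for every $\ell\ge1$ and every subset $S\subset F(x_1,\dots,x_\ell)$ there is a finite subset $S_0\subset S$ with $V_G(S_0)=V_G(S)$. *)

(* Defs.v *)
From HB Require Import structures.
From mathcomp Require Import all_boot all_order all_algebra finmap.
From mathcomp Require Import all_classical all_reals all_analysis.
From mathcomp Require Import wochoice.

Set Implicit Arguments.
Unset Strict Implicit.
Unset Printing Implicit Defensive.

Import Order.TTheory GRing.Theory Num.Theory.
Import numFieldNormedType.Exports.

Local Open Scope classical_set_scope.
Local Open Scope card_scope.
Local Open Scope ring_scope.

Section HyperbolicSpaces.
Context {R : realType} (X : metricType R).

Definition geodesic_space : Prop := forall x y : X, exists gamma : R -> X,
  [/\ gamma 0 = x, gamma (mdist x y) = y &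
      {in `[0, mdist x y] &, forall s t, mdist (gamma s) (gamma t) = `|s - t|}].

Definition gromov_product (w x y : X) : R :=
  (mdist x w + mdist y w - mdist x y) / 2.

Definition gromov_hyperbolic (delta : R) : Prop := forall w x y z : X,
  Num.min (gromov_product w x y) (gromov_product w y z) - delta
    <= gromov_product w x z.

Definition hyperbolic_space (delta : R) : Prop :=
  geodesic_space /\ gromov_hyperbolic delta.

(* (u_m | v_n)_w tends to +oo as m, n tend to infinity independently. The
   condition does not depend on the base point w. *)
Definition gromov_equiv (u v : nat -> X) : Prop := forall w : X,
  gromov_product w (u p.1) (v p.2) @[p --> (\oo, \oo)] --> +oo.

Definition gromov_sequence (u : nat -> X) : Prop := gromov_equiv u u.

Definition gromov_class (u : nat -> X) : set (nat -> X) :=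
  [set v | gromov_sequence v /\ gromov_equiv u v].

(* A point of the boundary is an equivalence class of sequences converging at
   infinity, viewed as a set of sequences. *)
Definition gromov_boundary : set (set (nat -> X)) :=
  [set gromov_class u | u in gromov_sequence].

End HyperbolicSpaces.

Section Actions.
Context {R : realType} {G : groupType} {X : metricType R} (to : G -> X -> X).

Definition isometric_action : Prop :=
  [/\ forall x, to 1%g x = x,
      forall g h x, to (g * h)%g x = to g (to h x) &
      forall g x y, mdist (to g x) (to g y) = mdist x y].

Definition acylindrical : Prop := forall epsilon : R, 0 < epsilon ->
  exists r : R, exists N : nat, [/\ 0 < r, (0 < N)%N &
    forall x y : X, r <= mdist x y ->
      [set g : G | mdist x (to g x) <= epsilon /\ mdist y (to g y) <= epsilon]
        #<= `I_N].

Definition limit_set : set (set (nat -> X)) :=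
  [set xi | gromov_boundary xi /\
            exists (x : X) (g : nat -> G), xi (fun n => to (g n) x)].

Definition elementary : Prop := limit_set #<= `I_2.

Definition hyperbolic_element (g : G) : Prop := exists x : X, exists C : R,
  0 < C /\ forall n : nat, (0 < n)%N -> C * n%:R < mdist x (to (g ^+ n)%g x).

End Actions.

Section Growth.
Context {G : groupType}.
Implicit Type S : set G.

(* Inverses of elements of S are not adjoined here: word_ball is meant for a
   symmetric S. *)
Definition word_ball S (n : nat) : set G :=
  [set (\prod_(x <- w) x)%g | w in
    [set w : seq G | (size w <= n)%N /\ forall x, x \in w -> S x]].

Definition finite_generating_set S : Prop :=
  [/\ finite_set S, [set (x^-1)%g | x in S] = S &
      \bigcup_n word_ball S n = setT].

(* The balls are finite and the limit exists when S is a finite generating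
   set, the only case where fset_set and limn are used. *)
Definition growth_rate (R : realType) S : R :=
  limn (fun n => #|` fset_set (word_ball S n)|%:R `^ n%:R^-1 : R).

End Growth.

Definition finitely_generated (G : groupType) : Prop :=
  exists S : set G, finite_generating_set S.

Definition growth_rates (R : realType) (G : groupType) : set R :=
  [set growth_rate R S | S in @finite_generating_set G].

Arguments growth_rates R G : clear implicits.

Section EquationallyNoetherian.

(* (i, false) stands for x_i and (i, true) for its inverse. *)
Definition reduced_word (l : nat) (w : seq ('I_l * bool)) : bool :=
  sorted (fun a b => ~~ ((a.1 == b.1) && (a.2 != b.2))) w.

(* The free group on x_0, ..., x_(l-1), each element being represented by its
   unique reduced word. *)
Definition free_group (l : nat) := {w : seq ('I_l * bool) | reduced_word w}.

Definition free_group_eval (G : groupType) (l : nat) (g : 'I_l -> G)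
    (s : free_group l) : G :=
  (\prod_(a <- val s) (if a.2 then (g a.1)^-1 else g a.1))%g.

Definition solution_set (G : groupType) (l : nat) (S : set (free_group l)) :
    set ('I_l -> G) :=
  [set g | forall s, S s -> free_group_eval g s = 1%g].

Arguments solution_set G {l} S.

Definition equationally_noetherian (G : groupType) : Prop :=
  forall (l : nat) (S : set (free_group l)), (0 < l)%N ->
  exists S0 : set (free_group l),
    [/\ finite_set S0, S0 `<=` S & solution_set G S0 = solution_set G S].

End EquationallyNoetherian.

(* Main.v *)
(** The whole argument rests on the quasi-supermultiplicativity of balls: there
    are constants C, c such that every finite generating set S satisfies
    |B_m(S)| |B_n(S)| <= C (m + 1) |B_(m+n+c)(S)|, hence
    |B_m(S)| <= C (m + 1) e(S)^(m+c), with C and c independent of S and m.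

    To prove it, fix S, choose a point x almost minimizing the maximal
    displacement L of a bounded power of S, and an element g of a bounded ball
    with |x - gx| close to L at least and (gx | g^-1 x)_x bounded; by
    acylindricity applied to the powers of a hyperbolic element of S^M, L may be
    assumed to be as large as one wants.  If the axis of g overlapped too much
    with all its translates by the generators, a power of g would generate a
    normal subgroup and the action would be elementary.  So some s in S moves
    the axis of g away from itself, and for all w, w' one of the four elements
    u = g^(+-Q) s g^(+-Q) makes the path w u w' nearly geodesic.  Conversely, if
    w u w' and u are known and the distance |x - wx| is known up to L/4, then w
    is determined up to boundedly many choices: two choices differ by an
    element z which shifts two segments of the diverging axes of u along
    themselves, so by acylindricity its commutators with the two corresponding
    conjugates of g take boundedly many values, and the elements commuting with
    both move x by a bounded amount.

    Suppose now that a set of growth rates has no minimum.  Its members below a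
    given one are realized by generating sets of bounded cardinality, that is by
    markings f_S of G by a fixed free group; take an ultralimit along S with
    e(S) decreasing.  As G is equationally Noetherian, almost every S satisfies
    all the relations of the ultralimit, so that each |B_m(S)| is at most the
    value of |B_m(S')| for almost every S'.  Taking S' with
    e(S') <= t < e(S) gives e(S)^m <= C (m + 1) t^(m+c) for all m > 0, which is
    absurd. *)

Require Import Defs.
From HB Require Import structures.
From mathcomp Require Import all_boot all_order all_algebra finmap.
From mathcomp Require Import all_classical all_reals all_analysis.
From mathcomp Require Import wochoice.
From mathcomp Require Import ring lra zify.

Set Implicit Arguments.
Unset Strict Implicit.
Unset Printing Implicit Defensive.

Import Order.TTheory GRing.Theory Num.Theory.

Local Open Scope classical_set_scope.
Local Open Scope card_scope.
Local Open Scope ring_scope.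

(** * Coarse geometry of hyperbolic spaces *)

(* lra for goals about distances: symmetry is taken into account and the
   distances are abstracted. *)
Ltac metric_lra :=
  repeat match goal with
  | H : context [mdist _ _] |- _ => revert H
  | H : context [gromov_product _ _ _] |- _ => revert H
  end;
  rewrite /gromov_product;
  repeat match goal with
  | |- context [mdist ?a ?b] => try rewrite (metric_sym b a);
      let u := fresh "u" in set u := mdist a b; clearbody u
  end;
  intros; lra.

Section MetricGeometry.
Context {R : realType} (X : metricType R).
Implicit Types (x y z w p q : X) (K E T : R).
Local Notation d := mdist.

Lemma gromov_productC w x y : gromov_product w x y = gromov_product w y x.
Proof. metric_lra. Qed.

Lemma gromov_product_ge0 w x y : 0 <= gromov_product w x y.
Proof. have := metric_triangle x w y; metric_lra. Qed.

Lemma gromov_product_swap w x y :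
  gromov_product w x y = d w x - gromov_product x w y.
Proof. metric_lra. Qed.

Lemma gromov_product_base w w' x y :
  gromov_product w x y <= gromov_product w' x y + d w w'.
Proof.
have := metric_triangle x w' w; have := metric_triangle y w' w; metric_lra.
Qed.

Lemma gromov_product_move w x x' y :
  gromov_product w x y <= gromov_product w x' y + d x x'.
Proof.
have := metric_triangle x x' w; have := metric_triangle x' x y; metric_lra.
Qed.

Lemma gromov_product_leD w x x' : d w x - d x x' <= gromov_product w x x'.
Proof. have := metric_triangle w x' x; metric_lra. Qed.

Section Hyperbolic.
Context (delta : R).
Hypothesis hypX : gromov_hyperbolic X delta.

Lemma delta_ge0 x : 0 <= delta.
Proof. by have := hypX x x x x; rewrite minxx; lra. Qed.

Lemma gromov_ineq w x y z :
  gromov_product w x y <= gromov_product w x z + delta \/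
  gromov_product w y z <= gromov_product w x z + delta.
Proof.
have := hypX w x y z; rewrite lerBlDr ge_min => /orP[]; [left|right]; lra.
Qed.

Lemma gromov_transfer K w x y z : gromov_product w x z <= K ->
  K + delta < gromov_product w x y -> gromov_product w y z <= K + delta.
Proof. by have [] := gromov_ineq w x y z; lra. Qed.

Lemma four_point x y z w :
  d x y + d z w <= d x z + d y w + 2 * delta \/
  d x y + d z w <= d x w + d y z + 2 * delta.
Proof.
have := gromov_ineq w x z y; rewrite /gromov_product (metric_sym z y).
by move=> [?|?]; [left|right]; lra.
Qed.

Lemma near_geodesic_dist E p q y z :
  gromov_product y p q <= E -> gromov_product z p q <= E ->
  d y z <= `|d p y - d p z| + 2 * E + 2 * delta.
Proof.
move=> hy hz.
have := ler_norm (d p y - d p z); have := ler_norm (- (d p y - d p z)).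
by rewrite normrN; have := four_point y z p q; metric_lra.
Qed.

Lemma near_geodesic_fork K x b e y :
  gromov_product y x b <= K -> d x y <= gromov_product x b e ->
  gromov_product y x e <= K + delta.
Proof.
have := gromov_product_ge0 y x b; have := four_point y e x b; metric_lra.
Qed.

(* The primes denote images under an isometry: if U and V, near a geodesic from
   p to q, move forward by T along it, so does every point y between them. *)
Lemma shift_near_geodesic E T p q U V U' V' y y' z : delta <= E ->
  gromov_product y p q <= E -> gromov_product z p q <= E ->
  gromov_product U p q <= E -> gromov_product V p q <= E ->
  gromov_product U' p q <= E -> gromov_product V' p q <= E ->
  d y' U' = d y U -> d y' V' = d y V ->
  `|d p U' - d p U - T| <= E -> `|d p V' - d p V - T| <= E ->
  d p U <= d p y -> d p y <= d p V -> `|d p z - d p y - T| <= E ->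
  d y' z <= 22 * E.
Proof.
move=> dE hy hz hU hV hU' hV' yU yV; rewrite !ler_norml.
move=> /andP[? ?] /andP[? ?] Uy yVl /andP[? ?].
have d0 := delta_ge0 p.
have l1 := near_geodesic_dist hy hU; have l2 := near_geodesic_dist hy hV.
rewrite ger0_norm in l1; last lra.
rewrite ler0_norm in l2; last lra.
have t1 := metric_triangle p U' y'; have t2 := metric_triangle y' V' q.
have t3 := metric_triangle p y' q.
have hy' : gromov_product y' p q <= 6 * E by metric_lra.
have hz' : gromov_product z p q <= 6 * E by lra.
have := near_geodesic_dist hy' hz'.
have : `|d p y' - d p z| <= 8 * E by rewrite ler_norml; metric_lra.
lra.
Qed.

(* An isometry moving three points at infinity in pairwise different directions
   by a bounded amount moves the center of the tripod by a bounded amount. *)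
Lemma three_ends K D tau (f : X -> X) x (P1 P2 P3 : X) :
  (forall y z, d (f y) (f z) = d y z) ->
  gromov_product x P1 P2 <= K ->
  gromov_product x P1 P3 <= D -> gromov_product x P2 P3 <= D -> K <= D ->
  d x (f x) <= tau -> d P1 (f P1) <= tau -> d P2 (f P2) <= tau ->
  d P3 (f P3) <= tau ->
  4 * D + 4 * tau + 4 * delta < d x P1 ->
  4 * D + 4 * tau + 4 * delta < d x P2 ->
  4 * D + 4 * tau + 4 * delta < d x P3 ->
  d x (f x) <= 2 * K + 30 * delta.
Proof.
move=> fd k12 k13 k23 KD tx t1 t2 t3 l1 l2 l3.
have d0 := delta_ge0 x.
have D0 := gromov_product_ge0 x P1 P3.
have tau0 := mdist_ge0 x (f x).
pose b P z := d (f P) z - d P z.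
(* The Busemann-type quantity b P z does not depend on the point z in the
   direction of another end. *)
have indep P y z : d P (f P) <= tau -> 2 * D + 4 * tau + 4 * delta < d x P ->
    gromov_product x P y <= D + tau -> gromov_product x P z <= D + tau ->
    `|b P y - b P z| <= 2 * delta.
  rewrite /b => tP lP hy hz.
  have e1 := four_point P y (f P) z; have e2 := four_point P z (f P) y.
  have e3 := metric_triangle y x z; have e4 := metric_triangle P (f P) y.
  have e5 := metric_triangle P (f P) z.
  rewrite ler_norml; clear k12 k13 k23 l1 l2 l3 t1 t2 t3 fd; metric_lra.
have anti P Q : d P (f P) <= tau -> d Q (f Q) <= tau ->
    gromov_product x P Q <= D -> 2 * D + 4 * tau + 4 * delta < d x P ->
    4 * tau + 4 * delta < d x Q -> `|b P Q + b Q P| <= 2 * delta.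
  rewrite /b => tP tQ hPQ lP lQ.
  have e0 := fd P Q; have e1 := four_point P Q (f P) (f Q).
  have e2 := four_point P (f Q) Q (f P).
  have e3 := metric_triangle P (f P) Q; have e4 := metric_triangle P Q (f Q).
  rewrite ler_norml; clear k12 k13 k23 l1 l2 l3 t1 t2 t3 fd; metric_lra.
have l1' : 2 * D + 4 * tau + 4 * delta < d x P1 by lra.
have l2' : 2 * D + 4 * tau + 4 * delta < d x P2 by lra.
have l3' : 2 * D + 4 * tau + 4 * delta < d x P3 by lra.
have k12' : gromov_product x P1 P2 <= D by lra.
have loose P y : gromov_product x P y <= D -> gromov_product x P y <= D + tau.
  by lra.
have [b12 b21] : `|b P1 P2| <= 6 * delta /\ `|b P2 P1| <= 6 * delta.
  have : `|b P1 P2 + b P2 P1| <= 2 * delta by apply: anti => //; lra.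
  have : `|b P1 P3 + b P3 P1| <= 2 * delta by apply: anti => //; lra.
  have : `|b P2 P3 + b P3 P2| <= 2 * delta by apply: anti => //; lra.
  have : `|b P1 P2 - b P1 P3| <= 2 * delta by apply: indep => //; exact: loose.
  have : `|b P2 P1 - b P2 P3| <= 2 * delta.
    by apply: indep => //; apply: loose; rewrite // gromov_productC.
  have : `|b P3 P1 - b P3 P2| <= 2 * delta.
    by apply: indep => //; apply: loose; rewrite gromov_productC.
  by rewrite !ler_norml; lra.
have fxD P : gromov_product x P (f x) <= D + tau.
  have := metric_triangle P (f x) x; metric_lra.
have : `|b P1 P2 - b P1 (f x)| <= 2 * delta by apply: indep => //; exact: loose.
have : `|b P2 P1 - b P2 (f x)| <= 2 * delta.
  by apply: indep => //; apply: loose; rewrite gromov_productC.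
rewrite {2 4}/b !fd !ler_norml => e2 e1; move: b12 b21; rewrite !ler_norml.
move=> b12 b21.
have hx : gromov_product x P1 P2 <= K + 9 * delta by lra.
have hfx : gromov_product (f x) P1 P2 <= K + 9 * delta.
  clear -e1 e2 b12 b21 k12; metric_lra.
have := near_geodesic_dist hx hfx.
have : `|d P1 x - d P1 (f x)| <= 8 * delta by rewrite ler_norml; lra.
lra.
Qed.

End Hyperbolic.
End MetricGeometry.

Section IsometricActions.
Context {R : realType} {G : groupType} {X : metricType R} {to : G -> X -> X}.
Hypothesis actX : isometric_action to.
Implicit Types (x y z w p q : X) (g h f : G) (K E T : R).
Local Notation d := mdist.
Local Notation "g .* x" := (to g%g x) (at level 40, left associativity).

Lemma act1 x : 1 .* x = x. Proof. by case: actX. Qed.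

Lemma actM g h x : (g * h) .* x = g .* (h .* x). Proof. by case: actX. Qed.

Lemma act_isom g x y : d (g .* x) (g .* y) = d x y. Proof. by case: actX. Qed.

Lemma actK g x : g^-1 .* (g .* x) = x.
Proof. by rewrite -actM mulVg act1. Qed.

Lemma actKV g x : g .* (g^-1 .* x) = x.
Proof. by rewrite -actM mulgV act1. Qed.

Lemma mdist_act g x y : d (g .* x) y = d x (g^-1 .* y).
Proof. by rewrite -(act_isom g x) actKV. Qed.

Lemma gromov_product_act g w x y :
  gromov_product (g .* w) (g .* x) (g .* y) = gromov_product w x y.
Proof. by rewrite /gromov_product !act_isom. Qed.

Lemma gromov_product_step f x y : gromov_product x (f .* x) (f .* y) =
  d x (f .* x) - gromov_product x (f^-1 .* x) y.
Proof.
by rewrite gromov_product_swap -(gromov_product_act f^-1 (f .* x)) !actK.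
Qed.

Definition quasi_axis K g x := forall m n,
  gromov_product x (g^-1 ^+ m .* x) (g ^+ n .* x) <= K.

Definition displacement g x n := d x (g ^+ n .* x).

Lemma quasi_axis_ge0 K g x : quasi_axis K g x -> 0 <= K.
Proof. by move=> /(_ 0%N 0%N); apply: le_trans; exact: gromov_product_ge0. Qed.

Lemma quasi_axisV K g x : quasi_axis K g x -> quasi_axis K g^-1%g x.
Proof. by move=> ax m n; rewrite gromov_productC invgK. Qed.

Lemma displacementV g x n : displacement g^-1%g x n = displacement g x n.
Proof.
by rewrite /displacement [RHS]metric_sym mdist_act expVgn.
Qed.

Lemma displacement_ge0 g x n : 0 <= displacement g x n.
Proof. exact: mdist_ge0. Qed.

Lemma displacement1 g x : displacement g x 1 = d x (g .* x).
Proof. by rewrite /displacement expg1. Qed.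

Lemma mdist_orbit g x m n :
  d (g ^+ m .* x) (g ^+ (m + n) .* x) = displacement g x n.
Proof. by rewrite expgnDr actM act_isom. Qed.

Lemma displacementD_le g x m n :
  displacement g x (m + n) <= displacement g x m + displacement g x n.
Proof.
have := metric_triangle x (g ^+ m .* x) (g ^+ (m + n) .* x).
by rewrite mdist_orbit.
Qed.

Lemma displacement_le g x n : displacement g x n <= n%:R * d x (g .* x).
Proof.
elim: n => [|n IH]; first by rewrite /displacement expg0 act1 mdistxx mul0r.
have := displacementD_le g x n 1; rewrite addn1 displacement1 => le.
by rewrite -natr1 mulrDl mul1r; lra.
Qed.

Section QuasiAxis.
Context (K : R) (g : G) (x : X).
Hypothesis ax : quasi_axis K g x.

Lemma quasi_axis_between i j k : (i <= j <= k)%N ->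
  gromov_product (g ^+ j .* x) (g ^+ i .* x) (g ^+ k .* x) <= K.
Proof.
move=> /andP[ij jk].
rewrite -(gromov_product_act (g ^+ j)^-1) -!actM mulVg act1.
have -> : ((g ^+ j)^-1 * g ^+ i)%g = (g^-1 ^+ (j - i))%g.
  by rewrite -{1}(subnKC ij) expgnDr invgM -mulgA mulVg mulg1 expVgn.
have -> : ((g ^+ j)^-1 * g ^+ k)%g = (g ^+ (k - j))%g.
  by rewrite -{1}(subnKC jk) expgnDr mulKg.
exact: ax.
Qed.

Lemma displacementD_ge m n :
  displacement g x m + displacement g x n - 2 * K <= displacement g x (m + n).
Proof.
have := @quasi_axis_between 0 m (m + n); rewrite expg0 act1 leq0n leq_addr.
move=> /(_ isT); have := mdist_orbit g x m n; rewrite /displacement.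
metric_lra.
Qed.

Lemma displacement_ge n : n%:R * (d x (g .* x) - 2 * K) <= displacement g x n.
Proof.
elim: n => [|n IH]; first by rewrite mul0r displacement_ge0.
have := displacementD_ge n 1; rewrite addn1 displacement1.
by rewrite -natr1 mulrDl mul1r; lra.
Qed.

End QuasiAxis.

Section Hyperbolic.
Context (delta : R).
Hypothesis hypX : gromov_hyperbolic X delta.

Lemma quasi_axis_of_step kappa g x :
  gromov_product x (g .* x) (g^-1 .* x) <= kappa ->
  2 * (kappa + 2 * delta) < d x (g .* x) -> quasi_axis (kappa + 2 * delta) g x.
Proof.
move=> hk ha.
have d0 := delta_ge0 hypX x.
have k0 := gromov_product_ge0 x (g .* x) (g^-1 .* x).
have step f : gromov_product x (f .* x) (f^-1 .* x) <= kappa ->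
    2 * (kappa + 2 * delta) < d x (f .* x) ->
    forall n, gromov_product x (f^-1 .* x) (f ^+ n.+1 .* x) <= kappa + delta.
  move=> fk fa; elim=> [|n IH]; first by rewrite expg1 gromov_productC; lra.
  rewrite gromov_productC.
  apply: (gromov_transfer hypX fk).
  by rewrite expgS actM gromov_product_step; lra.
have far f : gromov_product x (f .* x) (f^-1 .* x) <= kappa ->
    2 * (kappa + 2 * delta) < d x (f .* x) ->
    forall n, kappa + delta + delta < gromov_product x (f .* x) (f ^+ n.+1 .* x).
  move=> fk fa [|n].
    by rewrite expg1 /gromov_product mdistxx (metric_sym _ x); lra.
  have := step f fk fa n.
  by rewrite [(f ^+ n.+2)%g]expgS actM gromov_product_step; lra.
move=> [|m] n.
  by rewrite expg0 act1 /gromov_product mdistxx (metric_sym _ x); lra.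
case: n => [|n].
  by rewrite expg0 act1 /gromov_product mdistxx (metric_sym _ x); lra.
have -> : kappa + 2 * delta = kappa + delta + delta by lra.
apply: (gromov_transfer hypX (step g hk ha n)).
rewrite gromov_productC in hk.
by apply: far; rewrite ?invgK // metric_sym mdist_act invgK.
Qed.

End Hyperbolic.
End IsometricActions.

Arguments quasi_axis {R G X} to K g x.
Arguments displacement {R G X} to g x n.

(** * Elements with large displacement *)

Lemma geodesic_point {R : realType} (X : metricType R) (x y : X) (r : R) :
  geodesic_space X -> 0 <= r <= mdist x y ->
  exists2 z, mdist x z = r & mdist z y = mdist x y - r.
Proof.
move=> /(_ x y) [c [c0 c1 cd]] r0.
have i0 : 0 \in `[0, mdist x y] by rewrite in_itv/= lexx mdist_ge0.
have i1 : mdist x y \in `[0, mdist x y] by rewrite in_itv/= lexx mdist_ge0.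
have ir : r \in `[0, mdist x y] by rewrite in_itv/=.
exists (c r); first by rewrite -c0 cd // sub0r normrN ger0_norm //; case/andP: r0.
have := cd _ _ ir i1; rewrite c1 => ->.
by rewrite ler0_norm; [rewrite opprB | rewrite subr_le0; case/andP: r0].
Qed.

Section LargeDisplacement.
Context {R : realType} {G : groupType} {X : metricType R} {to : G -> X -> X}.
Context (delta : R).
Hypothesis actX : isometric_action to.
Hypothesis geoX : geodesic_space X.
Hypothesis hypX : gromov_hyperbolic X delta.
Local Notation d := mdist.
Local Notation "g .* x" := (to g%g x) (at level 40, left associativity).

Lemma near_minimal_point (F : set G) (B : R) (x0 : X) : finite_set F ->
  (forall y, exists2 s, F s & B < d y (s .* y)) ->
  exists x L, [/\ B <= L, forall s, F s -> d x (s .* x) <= L &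
    forall y, exists2 s, F s & L - 1 < d y (s .* y)].
Proof.
move=> Ffin big.
pose T := [set t : R | exists x, forall s, F s -> d x (s .* x) <= t].
have T_lb : lbound T B.
  by move=> t [x xt]; have [s Fs /ltW lt] := big x; exact: le_trans (xt s Fs).
have T_inf : has_inf T.
  split; last by exists B.
  exists (\sum_(s <- fset_set F) d x0 (s .* x0)); exists x0 => s Fs.
  have sF : s \in fset_set F by rewrite in_fset_set // inE.
  rewrite (big_fsetD1 s) //= lerDl; apply: sumr_ge0 => *; exact: mdist_ge0.
have [L [x xL] Lt] := inf_adherent (ltr01 : 0 < 1 :> R) T_inf.
exists x, L; split=> //; first exact: (T_lb L (ex_intro _ x xL)).
move=> y; apply: contrapT => small.
have : T (L - 1).
  exists y => s Fs; rewrite leNgt; apply/negP => lt; apply: small.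
  by exists s.
by move/(ge_inf T_inf.2); lra.
Qed.

(* If all elements of F with nearly maximal displacement at x moved x in the
   same direction, moving x a little in that direction would decrease the
   maximal displacement. *)
Lemma diverging_pair (F : set G) (x : X) (L : R) :
  (forall s, F s -> F s^-1%g) ->
  (forall s, F s -> d x (s .* x) <= L) ->
  (forall y, exists2 s, F s & L - 1 < d y (s .* y)) ->
  20 * delta + 20 <= L ->
  exists s t, [/\ F s, F t, L - (6 * delta + 3) < d x (s .* x),
    L - (6 * delta + 3) < d x (t .* x) &
    gromov_product x (s .* x) (t .* x) <= 3 * delta + 1].
Proof.
move=> FV xL xmin L_big; apply: contrapT => nodiv.
have d0 := delta_ge0 hypX x.
have agree s t : F s -> F t -> L - (6 * delta + 3) < d x (s .* x) ->
    L - (6 * delta + 3) < d x (t .* x) ->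
    3 * delta + 1 < gromov_product x (s .* x) (t .* x).
  by move=> *; rewrite ltNge; apply/negP => le; apply: nodiv; exists s, t.
have [s0 Fs0 s0_big] := xmin x.
have [|y xy ys0] := @geodesic_point _ _ x (s0 .* x) (3 * delta + 1) geoX.
  by lra.
have toward t : F t -> L - (6 * delta + 3) < d x (t .* x) ->
    d y (t .* x) <= d x (t .* x) - (delta + 1).
  move=> Ft t_big.
  have s0_big' : L - (6 * delta + 3) < d x (s0 .* x) by lra.
  have := agree s0 t Fs0 Ft s0_big' t_big.
  have := gromov_ineq hypX x y (s0 .* x) (t .* x).
  move: xy ys0; clear -d0; metric_lra.
have [s Fs] := xmin y.
have [s_big|s_small] := ltP (L - (6 * delta + 3)) (d x (s .* x)).
  have sV : d x (s^-1 .* x) = d x (s .* x).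
    by rewrite metric_sym mdist_act // invgK.
  have := toward s Fs s_big; have := toward s^-1%g (FV s Fs).
  rewrite sV => /(_ s_big); rewrite -(mdist_act actX).
  have := four_point hypX y (s .* y) x (s .* x); have := xL s Fs.
  rewrite (act_isom actX); move: xy s_big L_big; clear -d0; metric_lra.
have := metric_triangle y x (s .* y).
have := metric_triangle x (s .* x) (s .* y); rewrite (act_isom actX).
move: xy s_small; clear -d0; metric_lra.
Qed.

Lemma large_displacement (F : set G) (B : R) (x0 : X) : finite_set F ->
  (forall s, F s -> F s^-1%g) ->
  (forall y, exists2 s, F s & B < d y (s .* y)) ->
  20 * delta + 20 <= B ->
  exists x L g, [/\ B <= L, forall s, F s -> d x (s .* x) <= L,
    F g \/ exists s t, [/\ F s, F t & g = (s * t)%g],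
    L - (6 * delta + 3) <= d x (g .* x) &
    gromov_product x (g .* x) (g^-1 .* x) <= 7 * delta + 1].
Proof.
move=> Ffin FV big B_big.
have [x [L [BL xL xmin]]] := near_minimal_point x0 Ffin big.
have L_big : 20 * delta + 20 <= L by lra.
have [s [t [Fs Ft s_big t_big st]]] := diverging_pair FV xL xmin L_big.
have d0 := delta_ge0 hypX x.
exists x, L.
have [s_ok|s_bad] := leP (gromov_product x (s .* x) (s^-1 .* x)) (7 * delta + 1).
  by exists s; split=> //; [left|lra].
have [t_ok|t_bad] := leP (gromov_product x (t .* x) (t^-1 .* x)) (7 * delta + 1).
  by exists t; split=> //; [left|lra].
(* Here s, s^-1 move x in a common direction, and so do t, t^-1; since s and t
   move it in different directions, s^-1 t is hyperbolic. *)
have sVtV : gromov_product x (s^-1 .* x) (t^-1 .* x) <= 5 * delta + 1.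
  have := gromov_ineq hypX x (s .* x) (t^-1 .* x) (t .* x).
  have := gromov_ineq hypX x (s .* x) (s^-1 .* x) (t^-1 .* x).
  by rewrite (gromov_productC x (t^-1 .* x)); lra.
have gV : (s^-1 * t)^-1%g = (t^-1 * s)%g by rewrite invgM invgK.
have dV u : d x (u^-1 .* x) = d x (u .* x).
  by rewrite metric_sym mdist_act // invgK.
have dVM u v : d x ((u^-1 * v) .* x) = d (u .* x) (v .* x).
  by rewrite (actM actX) -(act_isom actX u) actKV.
have far u v : L - (6 * delta + 3) < d x (u .* x) ->
    gromov_product x (u .* x) (v .* x) <= 3 * delta + 1 ->
    L - (9 * delta + 4) <= gromov_product x ((u^-1 * v) .* x) (u^-1 .* x).
  have := dV u; have := dVM u v.
  have : d ((u^-1 * v) .* x) (u^-1 .* x) = d (v .* x) x.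
    by rewrite (actM actX) (act_isom actX).
  clear; metric_lra.
have gs := far s t s_big st.
rewrite gromov_productC in st; have gt := far t s t_big st.
exists (s^-1 * t)%g; split=> //.
- by right; exists s^-1%g, t; split=> //; exact: FV.
- rewrite dVM; move: st s_big t_big L_big; clear -d0; metric_lra.
- rewrite gV.
  have := gromov_ineq hypX x (s^-1 .* x) ((s^-1 * t) .* x) (t^-1 .* x).
  have := gromov_ineq hypX x ((s^-1 * t) .* x) ((t^-1 * s) .* x) (t^-1 .* x).
  by rewrite (gromov_productC x (s^-1 .* x)); lra.
Qed.

End LargeDisplacement.

(** * Acylindricity and overlapping axes *)

Lemma pigeonhole_card_le {T : Type} (A : set T) (N : nat) (f : nat -> T) :
  A #<= `I_N -> (forall i, (i <= N)%N -> A (f i)) ->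
  exists i j, [/\ (i < j)%N, (j <= N)%N & f i = f j].
Proof.
move=> AN fA; apply: contrapT => noij.
have finj : {in `I_N.+1 &, injective f}.
  move=> i j; rewrite !inE/= !ltnS => iN jN fij.
  by case: (ltngtP i j) => // ij; case: noij; [exists i, j|exists j, i].
have : `I_N.+1 #<= `I_N.
  apply: card_le_trans AN; rewrite -(card_le_eql (inj_card_eq finj)).
  by apply: subset_card_le => _ [i /= iN <-]; exact: fA.
by rewrite card_le_II ltnn.
Qed.

Lemma conj_expg (G : groupType) (s h : G) k :
  (s * h ^+ k * s^-1 = (s * h * s^-1) ^+ k)%g.
Proof. by have := conjXg h s^-1%g k; rewrite !conjgE invgK !mulgA. Qed.

Section Acylindricity.
Context {R : realType} {G : groupType} {X : metricType R} {to : G -> X -> X}.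
Hypothesis actX : isometric_action to.
Local Notation d := mdist.
Local Notation "g .* x" := (to g%g x) (at level 40, left associativity).

Lemma hyperbolic_unbounded (h : G) (y : X) (B : R) : hyperbolic_element to h ->
  exists2 n0, (0 < n0)%N & forall n, (n0 <= n)%N -> B < d y (h ^+ n .* y).
Proof.
move=> [x [C [C0 hC]]].
pose n0 := (Num.truncn ((`|B| + 2 * d x y) / C)).+1.
exists n0 => // n n0n; have n_gt0 : (0 < n)%N by exact: leq_trans n0n.
have lt1 := hC n n_gt0.
have : `|B| + 2 * d x y < C * n%:R.
  rewrite [C * _]mulrC -ltr_pdivrMr //; apply: lt_le_trans (truncnS_gt _) _.
  by rewrite ler_nat.
have := metric_triangle x y (h ^+ n .* x).
have := metric_triangle y (h ^+ n .* y) (h ^+ n .* x).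
rewrite (act_isom actX); have := ler_norm B; move: lt1; clear; metric_lra.
Qed.

Lemma acylindrical_power_displacement (B : R) : acylindrical to -> 0 < B ->
  exists N, forall h, hyperbolic_element to h ->
    forall y, exists2 i, (i <= N)%N & B < d y (h ^+ i .* y).
Proof.
move=> acyl /acyl[r [N [_ _ cardN]]]; exists N => h hh y; apply: contrapT => small.
have [n0 _ /(_ n0 (leqnn _)) far] := hyperbolic_unbounded y r hh.
have hi i : (i <= N)%N -> d y (h ^+ i .* y) <= B.
  by move=> iN; rewrite leNgt; apply/negP => lt; apply: small; exists i.
have [i iN|i [j [ij _ hij]]] :=
    pigeonhole_card_le (f := fun i => (h ^+ i)%g) (cardN y (h ^+ n0 .* y) (ltW far)).
  split; first exact: hi.
  by rewrite -(actM actX) -expgnDr addnC expgnDr (actM actX) (act_isom actX) hi.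
have hji : (h ^+ (j - i) = 1)%g.
  by rewrite expgnFr ?(ltnW ij) // hij mulgV.
have [n n_gt0 /(_ ((j - i) * n)%N)] := hyperbolic_unbounded y 0 hh.
rewrite leq_pmull ?subn_gt0 // expgnA hji expg1n (act1 actX) mdistxx ltxx.
by move=> /(_ isT).
Qed.

Lemma displacement_lb (K : R) (h : G) (x : X) (i j : nat) : quasi_axis to K h x ->
  2 * K <= d x (h .* x) -> (i <= j)%N ->
  i%:R * (d x (h .* x) - 2 * K) <= displacement to h x j.
Proof.
move=> ax aK ij; apply: le_trans (displacement_ge actX ax j).
by rewrite ler_wpM2r ?ler_nat // subr_ge0.
Qed.

Section Overlap.
Context (delta : R).
Hypothesis hypX : gromov_hyperbolic X delta.

Lemma axis_overlap (K L r eps : R) (N Q : nat) (h h' s : G) (x : X) :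
  (forall y z, r <= d y z ->
    [set g | d y (g .* y) <= eps /\ d z (g .* z) <= eps] #<= `I_N) ->
  quasi_axis to K h x -> quasi_axis to K h' x ->
  (forall n, displacement to h' x n = displacement to h x n) ->
  delta <= K -> d x (s .* x) <= L -> 1000 * K <= L -> 0 < L ->
  L - 3 * K <= d x (h .* x) -> d x (h .* x) <= 2 * L -> r <= d x (h .* x) ->
  88 * K <= eps -> (N + 8 <= Q)%N ->
  (2 * N + 17)%:R * L <= gromov_product x (h ^+ Q .* x) ((s * h' ^+ Q) .* x) ->
  exists2 m, (0 < m <= N)%N & (s * h' ^+ m * s^-1 = h ^+ m)%g.
Proof.
move=> acyl ax ax' hh' dK sL KL L0 aL aL2 ra Keps NQ ovl.
have d0 := delta_ge0 hypX x; have K0 := quasi_axis_ge0 ax.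
pose a := d x (h .* x); pose A := displacement to h x.
rewrite -/a in aL aL2 ra.
have aE : d x (h' .* x) = a by rewrite -(displacement1 h') hh' displacement1.
pose pt j := (s * h' ^+ j) .* x.
have lb i j : (i <= j)%N -> i%:R * (a - 2 * K) <= A j.
  by move=> ij; apply: displacement_lb => //; rewrite -/a; lra.
have ub j : A j <= j%:R * a by exact: displacement_le.
have pt_between j k : (2 <= j <= k)%N -> gromov_product (pt j) x (pt k) <= 2 * K.
  move=> /andP[j2 jk].
  suff : gromov_product (pt j) x (pt k) <= K + delta by lra.
  apply: (gromov_transfer hypX (x := s .* x)).
    rewrite /pt !(actM actX) gromov_product_act //.
    have := @quasi_axis_between _ _ _ _ actX _ _ _ ax' 0 j k.
    by rewrite leq0n jk expg0 act1 // => /(_ isT).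
  have := gromov_product_leD (pt j) (s .* x) x.
  have -> : d (pt j) (s .* x) = A j.
    by rewrite /pt (actM actX) act_isom // metric_sym; exact: hh'.
  have := lb 2 j j2; move: sL; rewrite (metric_sym _ x); lra.
have pt_dist j : (j <= N + 8)%N -> d x (pt j) <= (2 * N + 17)%:R * L.
  move=> jN; have := metric_triangle x (s .* x) (pt j).
  rewrite {2}/pt (actM actX) act_isom // -/(displacement to h' x j) hh'.
  have : A j <= (N + 8)%:R * (2 * L).
    apply: le_trans (ub j) _; apply: ler_pM; rewrite ?ler_nat //.
    exact: mdist_ge0.
  have -> : (N + 8)%:R = N%:R + 8 :> R by rewrite natrD.
  have -> : (2 * N + 17)%:R = 2 * N%:R + 17 :> R by rewrite natrD natrM.
  by rewrite /A; lra.
have pt_near j : (2 <= j <= N + 8)%N ->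
    gromov_product (pt j) x (h ^+ Q .* x) <= 4 * K.
  move=> /andP[j2 jN].
  suff : gromov_product (pt j) x (h ^+ Q .* x) <= 2 * K + delta by lra.
  apply: (near_geodesic_fork hypX (b := pt Q)).
    by apply: pt_between; rewrite j2 (leq_trans jN).
  by rewrite gromov_productC; apply: le_trans ovl; exact: pt_dist.
have pt_step j i : (2 <= j)%N -> `|d x (pt (j + i)%N) - d x (pt j) - A i| <= 4 * K.
  move=> j2; have : gromov_product (pt j) x (pt (j + i)%N) <= 2 * K.
    by apply: pt_between; rewrite j2 leq_addr.
  have : d (pt j) (pt (j + i)%N) = A i.
    by rewrite /pt !(actM actX) act_isom // mdist_orbit // hh'.
  rewrite ler_norml; have := metric_triangle x (pt j) (pt (j + i)%N).
  generalize (A i); clear -K0; metric_lra.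
have h_near j : (j <= Q)%N -> gromov_product (h ^+ j .* x) x (h ^+ Q .* x) <= 4 * K.
  move=> jQ; have := @quasi_axis_between _ _ _ _ actX _ _ _ ax 0 j Q.
  by rewrite leq0n jQ expg0 act1 // => /(_ isT); lra.
have h_step j i : `|A (j + i)%N - A j - A i| <= 4 * K.
  have := displacementD_le actX h x j i; have := displacementD_ge actX ax j i.
  by rewrite ler_norml /A; lra.
have moved b i : (4 <= b <= 5)%N -> (i <= N)%N ->
    d (h ^+ b .* x) (((h ^+ i)^-1 * (s * h' ^+ i * s^-1)) .* (h ^+ b .* x))
      <= 88 * K.
  move=> /andP[b4 b5] iN.
  rewrite (actM actX) -mdist_act // metric_sym.
  have -> : 88 * K = 22 * (4 * K) by lra.
  have iN2 k : (k <= 8)%N -> (k + i <= N + 8)%N.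
    by move=> k8; rewrite addnC leq_add.
  have pt_move k : d ((s * h' ^+ i * s^-1) .* (h ^+ b .* x)) (pt (k + i)%N) =
      d (h ^+ b .* x) (pt k).
    have cE : (s * h' ^+ (k + i) = s * h' ^+ i * s^-1 * (s * h' ^+ k))%g.
      by rewrite mulgA mulgVK -mulgA -expgnDr addnC.
    by rewrite /pt cE (actM actX _ (s * _)) act_isom.
  apply: (shift_near_geodesic hypX (T := A i) (p := x) (q := h ^+ Q .* x)
    (U := pt 2) (V := pt 8) (U' := pt (2 + i)%N) (V' := pt (8 + i)%N)
    (y := h ^+ b .* x)) => //.
  - lra.
  - by apply: h_near; clear -b5 iN NQ; lia.
  - by rewrite -(actM actX) -expgnDr; apply: h_near; clear -b5 iN NQ; lia.
  - by apply: pt_near; clear -iN; lia.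
  - by apply: pt_near; clear -iN; lia.
  - by apply: pt_near; clear -iN; lia.
  - by apply: pt_near; clear -iN; lia.
  - exact: pt_step.
  - exact: pt_step.
  - have := metric_triangle x (s .* x) (pt 2).
    rewrite {2}/pt (actM actX) act_isom // -/(displacement to h' x 2) hh'.
    have := ub 2%N; have := lb 4%N b b4; rewrite /A /displacement; lra.
  - have := metric_triangle (s .* x) x (pt 8).
    rewrite {1}/pt (actM actX) act_isom // -/(displacement to h' x 8) hh'.
    have : A b <= 5 * a.
      by apply: le_trans (ub b) _; rewrite ler_wpM2r ?mdist_ge0 // ler_nat.
    rewrite (metric_sym _ x); have := lb 8%N 8%N (leqnn _).
    by rewrite /A /displacement; lra.
  - by rewrite -(actM actX) -expgnDr addnC; exact: h_step.
have [|i iN|i [j [ij jN eij]]] := pigeonhole_card_le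
  (f := fun i => ((h ^+ i)^-1 * (s * h' ^+ i * s^-1))%g)
  (acyl (h ^+ 4 .* x) (h ^+ 5 .* x) _).
- by rewrite -addn1 mdist_orbit // displacement1.
- by split; apply: le_trans Keps; apply: moved.
exists (j - i)%N; first by clear -ij jN; lia.
move: eij; rewrite !conj_expg; set c := (s * h' * s^-1)%g => eij.
apply: (@mulIg _ (c ^+ i)%g); rewrite -expgnDr subnK ?(ltnW ij) //.
rewrite expgnFr ?(ltnW ij) // -mulgA eij.
by rewrite mulVKg.
Qed.

End Overlap.
End Acylindricity.

Section GromovSequences.
Import numFieldNormedType.Exports.
Context {R : realType} {X : metricType R} (delta : R).
Hypothesis hypX : gromov_hyperbolic X delta.
Implicit Types (u v : nat -> X).

Lemma gromov_equivP u v : gromov_equiv u v <-> forall w T, exists N,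
  forall m n, (N <= m)%N -> (N <= n)%N -> T <= gromov_product w (u m) (v n).
Proof.
split=> [uv w T|uv w].
  have /cvgryPge/(_ T) := uv w.
  move=> [[A B] /= [[N1 _ hA] [N2 _ hB]] AB].
  exists (maxn N1 N2) => m n; rewrite !geq_max => /andP[m1 _] /andP[_ n2].
  by apply: (AB (m, n)); split; [apply: hA | apply: hB].
apply/cvgryPge => T; have [N hN] := uv w T.
exists ([set m | (N <= m)%N], [set n | (N <= n)%N]).
  by split; exists N.
by move=> [m n] /= [Nm Nn]; exact: hN.
Qed.

Lemma gromov_equiv_base x u v : (forall T, exists N,
    forall m n, (N <= m)%N -> (N <= n)%N -> T <= gromov_product x (u m) (v n)) ->
  gromov_equiv u v.
Proof.
move=> uv; apply/gromov_equivP => w T; have [N hN] := uv (T + mdist x w).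
exists N => m n Nm Nn; have := hN m n Nm Nn.
by have := gromov_product_base x w (u m) (v n); lra.
Qed.

Lemma gromov_equiv_sym u v : gromov_equiv u v -> gromov_equiv v u.
Proof.
move=> /gromov_equivP uv; apply/gromov_equivP => w T; have [N hN] := uv w T.
by exists N => m n Nm Nn; rewrite gromov_productC; exact: hN.
Qed.

Lemma gromov_equiv_trans u v w :
  gromov_equiv u v -> gromov_equiv v w -> gromov_equiv u w.
Proof.
move=> /gromov_equivP uv /gromov_equivP vw; apply/gromov_equivP => x T.
have [N1 h1] := uv x (T + delta); have [N2 h2] := vw x (T + delta).
exists (maxn N1 N2) => m n; rewrite !geq_max => /andP[m1 m2] /andP[n1 n2].
have := h1 m (maxn N1 N2) m1 (leq_maxl _ _).
have := h2 (maxn N1 N2) n (leq_maxr _ _) n2.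
by have := gromov_ineq hypX x (u m) (v (maxn N1 N2)) (w n); lra.
Qed.

Lemma gromov_class_eq u v : gromov_equiv u v -> gromov_class u = gromov_class v.
Proof.
move=> uv; apply/seteqP; split=> w [gw e]; split=> //.
  by apply: gromov_equiv_trans e; exact: gromov_equiv_sym.
exact: gromov_equiv_trans e.
Qed.

End GromovSequences.

Section Elementary.
Context {R : realType} {G : groupType} {X : metricType R} {to : G -> X -> X}.
Context (delta : R).
Hypothesis actX : isometric_action to.
Hypothesis hypX : gromov_hyperbolic X delta.
Local Notation d := mdist.
Local Notation "g .* x" := (to g%g x) (at level 40, left associativity).

Section NormalAxis.
Context (K : R) (f : G) (x : X).
Hypothesis ax : quasi_axis to K f x.
Hypothesis fx : 2 * K < d x (f .* x).

Let F (e : bool) (n : nat) : X := (if e then f else f^-1) ^+ n .* x.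

Lemma axis_ray_far T : exists N, forall e n, (N <= n)%N -> T <= d x (F e n).
Proof.
have fx0 : 0 < d x (f .* x) - 2 * K by rewrite subr_gt0.
exists (Num.truncn (T / (d x (f .* x) - 2 * K))).+1 => e n Nn.
have -> : d x (F e n) = displacement to f x n.
  by case: e => //; exact: displacementV.
apply: le_trans (displacement_ge actX ax n).
rewrite -ler_pdivrMr //; apply/ltW/(lt_le_trans (truncnS_gt _)).
by rewrite ler_nat.
Qed.

Lemma axis_ray_gromov e : gromov_sequence (F e).
Proof.
apply: (gromov_equiv_base (x := x)) => T.
have [N hN] := axis_ray_far (T + K); exists N.
have axe : quasi_axis to K (if e then f else f^-1)%g x.
  by case: e => //; exact: quasi_axisV.
suff main m n : (N <= m)%N -> (m <= n)%N -> T <= gromov_product x (F e m) (F e n).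
  move=> m n Nm Nn; have [mn|/ltnW mn] := leqP m n; first exact: main.
  by rewrite gromov_productC; exact: main.
move=> Nm mn; have := hN e m Nm.
have := quasi_axis_between actX axe (i := 0) (j := m) (k := n).
rewrite leq0n mn expg0 (act1 actX) => /(_ isT).
by rewrite [gromov_product x (F e m) _]gromov_product_swap /F; lra.
Qed.

Hypothesis fnormal : forall k : G, (k * f * k^-1)%g = f \/ (k * f * k^-1)%g = f^-1%g.

Lemma orbit_near_axis k : exists N, forall n, (N <= n)%N ->
  gromov_product (k .* x) (F false n) (F true n) <= K + 2 * delta.
Proof.
have d0 := delta_ge0 hypX x.
have [N hN] := axis_ray_far (K + 2 * delta + d x (k .* x) + 1).
exists N => n Nn.
rewrite -(gromov_product_act actX k^-1%g) (actK actX).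
have [e he] : exists e : bool, forall b : bool,
    (k^-1 * (if b then f else f^-1) * k = if b (+) e then f else f^-1)%g.
  have fV : (k^-1 * f^-1 * k = (k^-1 * f * k)^-1)%g.
    by rewrite !invgM invgK mulgA.
  have := fnormal k^-1%g; rewrite invgK => -[kf|kf].
    by exists false => -[]; rewrite ?addbF //= fV kf.
  by exists true => -[] /=; rewrite ?fV kf ?invgK.
have moved b : d (F (b (+) e) n) (k^-1 .* F b n) = d x (k .* x).
  have -> : F (b (+) e) n = (k^-1 * (if b then f else f^-1) ^+ n * k) .* x.
    by rewrite /F -he -{2 4}(invgK k) conj_expg.
  by rewrite !(actM actX) !(act_isom actX) metric_sym.
have kb b : K + 2 * delta + 1 <= gromov_product x (F (b (+) e) n) (k^-1 .* F b n).
  have := gromov_product_leD x (F (b (+) e) n) (k^-1 .* F b n).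
  by rewrite moved; have := hN (b (+) e) n Nn; lra.
have K1 : gromov_product x (F (false (+) e) n) (F (true (+) e) n) <= K.
  by case: (e); [rewrite gromov_productC|]; exact: ax.
have k1 := kb false; have k2 := kb true.
have s1 : gromov_product x (k^-1 .* F false n) (F (true (+) e) n) <= K + delta.
  by apply: (gromov_transfer hypX K1); lra.
have -> : K + 2 * delta = K + delta + delta by lra.
rewrite gromov_productC; rewrite gromov_productC in s1.
by apply: (gromov_transfer hypX s1); lra.
Qed.

Lemma orbit_toward_axis_end k N0 : exists e n, (N0 <= n)%N /\
  (d x (k .* x) - K - 2 * delta) / 2 <= gromov_product x (k .* x) (F e n).
Proof.
have [N hN] := orbit_near_axis k.
have [N1 hN1] := axis_ray_far 0.
have := hN (maxn N N0) (leq_maxl _ _); set n := maxn N N0 => hn.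
have K1 : gromov_product x (F false n) (F true n) <= K by exact: ax.
have : d x (k .* x) - K - 2 * delta <=
    gromov_product x (k .* x) (F true n) + gromov_product x (k .* x) (F false n).
  have := gromov_product_ge0 x (F false n) (F true n).
  move: hn K1; clear; metric_lra.
have [le _|lt ge] := leP ((d x (k .* x) - K - 2 * delta) / 2)
  (gromov_product x (k .* x) (F true n)).
  by exists true, n; rewrite leq_maxr.
by exists false, n; rewrite leq_maxr; split=> //; lra.
Qed.

Lemma orbit_gromov_sequence (k : nat -> G) (x0 : X) :
  gromov_sequence (fun n => k n .* x0) ->
  exists e, gromov_equiv (fun n => k n .* x0) (F e).
Proof.
set u := fun n => _ => u_gromov; have d0 := delta_ge0 hypX x.
have ugr := (gromov_equivP u u).1 u_gromov.
have close T N0 : exists e n j, [/\ (N0 <= n)%N, (N0 <= j)%N &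
    T <= gromov_product x (u n) (F e j)].
  have [N hN] := ugr x (2 * T + K + 2 * delta + 3 * d x x0).
  have := hN (maxn N N0) (maxn N N0) (leq_maxl _ _) (leq_maxl _ _).
  set n := maxn N N0 => un.
  have [e [j [N0j hj]]] := orbit_toward_axis_end (k n) N0.
  exists e, n, j; split=> //; first exact: leq_maxr.
  have mv : d (k n .* x) (u n) = d x x0 by exact: act_isom.
  have := gromov_product_move x (k n .* x) (u n) (F e j).
  have := metric_triangle x (k n .* x) (u n).
  have : gromov_product x (u n) (u n) = d x (u n).
    by rewrite /gromov_product mdistxx (metric_sym _ x); lra.
  by rewrite mv; lra.
have [e he] : exists e, forall T N0, exists n j, [/\ (N0 <= n)%N, (N0 <= j)%N &
    T <= gromov_product x (u n) (F e j)].
  apply: contrapT => none.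
  have none' e : exists T N0, forall n j, (N0 <= n)%N -> (N0 <= j)%N ->
      gromov_product x (u n) (F e j) < T.
    apply: contrapT => ne; apply: none; exists e => T N0; apply: contrapT => no.
    apply: ne; exists T, N0 => n j nN jN; rewrite ltNge; apply/negP => le.
    by apply: no; exists n, j.
  have [T1 [N1 h1]] := none' true; have [T2 [N2 h2]] := none' false.
  have [e [n [j []]]] := close (Num.max T1 T2) (maxn N1 N2).
  rewrite !geq_max ge_max => /andP[n1 n2] /andP[j1 j2] /andP[t1 t2].
  by case: e t1 t2 => t1 t2; [have := h1 n j n1 j1|have := h2 n j n2 j2]; lra.
exists e; apply: (gromov_equiv_base (x := x)) => T.
have [N1 h1] := ugr x (T + 2 * delta).
have /gromov_equivP/(_ x (T + 2 * delta))[N2 h2] := axis_ray_gromov e.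
have [n [j [nN jN hnj]]] := he (T + 2 * delta) (maxn N1 N2).
exists (maxn N1 N2) => m i; rewrite !geq_max => /andP[m1 m2] /andP[i1 i2].
move: nN jN; rewrite !geq_max => /andP[n1 n2] /andP[j1 j2].
have := h1 m n m1 n1; have := h2 j i j2 i2.
have := gromov_ineq hypX x (u m) (u n) (F e i).
by have := gromov_ineq hypX x (u n) (F e j) (F e i); lra.
Qed.

Lemma elementary_of_normal_axis : elementary to.
Proof.
apply: (@card_le_trans _ _ _ ((fun i => gromov_class (F (i == 0%N))) @` `I_2));
  last exact: card_image_le.
apply: subset_card_le => _ [[v v_gromov <-] [x0 [k [k_gromov vk]]]].
have [e ke] := orbit_gromov_sequence k_gromov.
have ve := gromov_equiv_trans hypX vk ke.
by exists (~~ e : nat); [case: e {ke ve} | rewrite (gromov_class_eq hypX ve) eqb0 negbK].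
Qed.

End NormalAxis.
End Elementary.

(** * Counting and word balls *)

Section Counting.
Implicit Types (T U : choiceType).

Definition ncard {T : choiceType} (A : set T) : nat := #|` fset_set A|.

Lemma ncard_sub T (A B : set T) : finite_set B -> A `<=` B ->
  (ncard A <= ncard B)%N.
Proof.
move=> Bfin AB; apply: fsubset_leq_card; rewrite -fset_set_sub //.
exact: sub_finite_set Bfin.
Qed.

Lemma ncard_fibers T U (A : set T) (B : set U) (f : T -> U) (k : nat) :
  finite_set A -> finite_set B -> (forall a, A a -> B (f a)) ->
  (forall b, B b -> (ncard (A `&` [set a | f a = b]) <= k)%N) ->
  (ncard A <= k * ncard B)%N.
Proof.
move=> Af Bf fAB fib; rewrite {1}/ncard card_fset_sum1 (partition_big_imfset _ f).
apply: (@leq_trans (\sum_(b <- [fset f x | x in fset_set A]%fset) k)).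
  rewrite !big_seq; apply: leq_sum => _ /imfsetP[a /= aA ->].
  move: aA; rewrite in_fset_set // inE => aA.
  apply: leq_trans (fib _ (fAB a aA)); rewrite /ncard card_fset_sum1.
  have -> : fset_set (A `&` [set a' | f a' = f a]) =
      [fset a' in fset_set A | f a' == f a]%fset.
    apply/fsetP => a'; rewrite in_fset_set; last exact: finite_setIl.
    rewrite !inE in_fset_set //; apply/idP/andP => [/set_mem[? /eqP ?]|].
      by split=> //; exact: mem_set.
    by move=> [/set_mem ? /eqP ?]; apply: mem_set.
  by rewrite big_fset_condE.
rewrite big_const_seq count_predT iter_addn_0 leq_mul2l.
apply/orP; right; apply: fsubset_leq_card; apply/fsubsetP => _ /imfsetP[a /= aA ->].
by move: aA; rewrite !in_fset_set // !inE; exact: fAB.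
Qed.

Lemma ncard_inj T U (A : set T) (B : set U) (f : T -> U) :
  finite_set B -> {in A &, injective f} -> (forall a, A a -> B (f a)) ->
  finite_set A -> (ncard A <= ncard B)%N.
Proof.
move=> Bf finj fAB Af; rewrite -[leqRHS]mul1n; apply: (ncard_fibers Af Bf fAB).
move=> b _; apply: geq_card_fset_set.
have [->|/set0P[a [Aa fa]]] := eqVneq (A `&` [set a | f a = b]) set0.
  exact: card_ge0.
apply: (@card_le_trans _ _ _ [set a]); last first.
  by have := @card_set1 _ a; rewrite card_eq_le => /andP[].
apply: subset_card_le => a' [Aa' fa'].
by apply: finj; rewrite ?inE // fa' fa.
Qed.

Lemma cardfsM T U (A : {fset T}) (B : {fset U}) :
  #|` A `*` B|%fset = (#|` A| * #|` B|)%N.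
Proof.
rewrite /fsetM (perm_size (enum_imfset2 _ _)) /=; last first.
  by move=> [? ?] [? ?] ? ? /= [-> ->].
by rewrite size_allpairs.
Qed.

Lemma ncard_setX T U (A : set T) (B : set U) : finite_set A -> finite_set B ->
  ncard (A `*` B) = (ncard A * ncard B)%N.
Proof. by move=> Af Bf; rewrite /ncard fset_setX // cardfsM. Qed.

Lemma ncard_II (n : nat) : ncard `I_n = n.
Proof. exact: card_fset_set (card_eqxx _). Qed.

End Counting.

Section WordBalls.
Context {G : groupType} (S : set G).

Lemma word_ball_one n : word_ball S n 1%g.
Proof. by exists [::]; rewrite ?big_nil //; split. Qed.

Lemma word_ball_sub m n g : (m <= n)%N -> word_ball S m g -> word_ball S n g.
Proof.
by move=> mn [w [wm wS] <-]; exists w => //; split=> //; exact: leq_trans mn.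
Qed.

Lemma word_ball_gen s : S s -> word_ball S 1 s.
Proof.
move=> Ss; exists [:: s]; last by rewrite big_seq1.
by split=> // x; rewrite inE => /eqP ->.
Qed.

Lemma word_ballM m n g h : word_ball S m g -> word_ball S n h ->
  word_ball S (m + n) (g * h)%g.
Proof.
move=> [v [vm vS] <-] [w [wn wS] <-]; exists (v ++ w); last by rewrite big_cat.
split; first by rewrite size_cat leq_add.
by move=> x; rewrite mem_cat => /orP[/vS|/wS].
Qed.

Lemma word_ballX m n g : word_ball S m g -> word_ball S (n * m) (g ^+ n)%g.
Proof.
move=> mg; elim: n => [|n IH]; first by rewrite expg0; exact: word_ball_one.
by rewrite mulSn expgS; exact: word_ballM.
Qed.

Lemma word_ball_split m n g : word_ball S (m + n) g ->
  exists h k, [/\ word_ball S m h, word_ball S n k & g = (h * k)%g].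
Proof.
move=> [w [wmn wS] <-].
exists (\prod_(x <- take m w) x)%g, (\prod_(x <- drop m w) x)%g; split.
- exists (take m w) => //; split; first by rewrite size_take_min geq_minl.
  by move=> x /mem_take /wS.
- exists (drop m w) => //; split; first by rewrite size_drop leq_subLR.
  by move=> x /mem_drop /wS.
- by rewrite -big_cat cat_take_drop.
Qed.

Lemma word_ball_closed (P : set G) : P 1%g -> (forall s g, S s -> P g -> P (s * g)%g) ->
  forall n g, word_ball S n g -> P g.
Proof.
move=> P1 PM n _ [w [_ wS] <-]; elim: w wS => [|s w IH] wS; first by rewrite big_nil.
rewrite big_cons; apply: PM; first by apply: wS; rewrite mem_head.
by apply: IH => x xw; apply: wS; rewrite inE xw orbT.
Qed.

Lemma word_ball_finite n : finite_set S -> finite_set (word_ball S n).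
Proof.
move=> Sfin; elim: n => [|n IH].
  apply: (@sub_finite_set _ _ [set 1%g]) => // _ [w [w0 _] <-].
  by move: w0; rewrite leqn0 size_eq0 => /eqP ->; rewrite big_nil.
have S1fin : finite_set (1%g |` S) by rewrite finite_setU.
apply: sub_finite_set (finite_image2 (fun a b => (a * b)%g) S1fin IH).
move=> _ [w [wn wS] <-]; case: w wn wS => [|s w] wn wS.
  by exists 1%g; [left|exists 1%g; rewrite ?big_nil ?mulg1 //; exact: word_ball_one].
exists s; first by right; apply: wS; rewrite mem_head.
exists (\prod_(x <- w) x)%g; last by rewrite big_cons.
by exists w => //; split=> // x xw; apply: wS; rewrite inE xw orbT.
Qed.

Lemma word_ballV n g : [set (x^-1)%g | x in S] = S ->
  word_ball S n g -> word_ball S n g^-1%g.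
Proof.
move=> SV [w [wn wS] <-]; exists (rev (map (fun x => x^-1)%g w)).
  split; first by rewrite size_rev size_map.
  move=> x; rewrite mem_rev => /mapP[y /wS Sy ->].
  by rewrite -SV; exists y.
by rewrite -map_rev big_map prodgV revK.
Qed.

End WordBalls.

(** * Separators *)

Section QuasiAxisOps.
Context {R : realType} {G : groupType} {X : metricType R} {to : G -> X -> X}.
Hypothesis actX : isometric_action to.
Local Notation d := mdist.
Local Notation "g .* x" := (to g%g x) (at level 40, left associativity).

Lemma quasi_axisX (K : R) (g : G) (x : X) n : quasi_axis to K g x ->
  quasi_axis to K (g ^+ n)%g x.
Proof. by move=> ax i j; rewrite -expVgn -!expgnA; exact: ax. Qed.

Lemma act_conj_expg (u g : G) (x : X) n :
  (u * g * u^-1) ^+ n .* (u .* x) = u .* (g ^+ n .* x).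
Proof. by rewrite -conj_expg -!(actM actX) mulgVK. Qed.

Lemma quasi_axis_conj (K : R) (u g : G) (x : X) : quasi_axis to K g x ->
  quasi_axis to K (u * g * u^-1)%g (u .* x).
Proof.
move=> ax i j; have -> : ((u * g * u^-1)^-1 = u * g^-1 * u^-1)%g.
  by rewrite !invgM invgK mulgA.
by rewrite !act_conj_expg gromov_product_act.
Qed.

Lemma displacement_conj (u g : G) (x : X) n :
  displacement to (u * g * u^-1)%g (u .* x) n = displacement to g x n.
Proof. by rewrite /displacement act_conj_expg (act_isom actX). Qed.

Section Hyperbolic.
Context (delta : R).
Hypothesis hypX : gromov_hyperbolic X delta.

Lemma twist_displacement (K sigma : R) (f w v : G) (y0 p q : X) :
  delta <= K -> quasi_axis to K f y0 ->
  (forall j, (j <= 4)%N -> gromov_product (w .* (f ^+ j .* y0)) p q <= 12 * K) ->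
  (forall j, (j <= 4)%N -> gromov_product (v .* (f ^+ j .* y0)) p q <= 12 * K) ->
  (forall j, (j <= 4)%N -> `|d p (w .* (f ^+ j .* y0)) - d p (w .* y0) -
     displacement to f y0 j| <= 12 * K) ->
  (forall j, (j <= 4)%N -> `|d p (v .* (f ^+ j .* y0)) - d p (v .* y0) -
     displacement to f y0 j| <= 12 * K) ->
  `|d p (w .* y0) - d p (v .* y0)| <= sigma ->
  sigma + 100 * K <= d y0 (f .* y0) ->
  let z := (w^-1 * v)%g in let c := (z * f * z^-1 * f^-1)%g in
  forall j, (2 <= j <= 3)%N -> d (f ^+ j .* y0) (c .* (f ^+ j .* y0)) <= 1056 * K.
Proof.
move=> dK ax gw gv pw pv wv sa /= j /andP[j2 j3].
case: j j2 j3 => // j j1 j2.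
have -> : ((w^-1 * v * f * (w^-1 * v)^-1 * f^-1) .* (f ^+ j.+1 .* y0) =
    w^-1 .* ((v * f * v^-1) .* (w .* (f ^+ j .* y0)))).
  rewrite -!(actM actX); congr to.
  by rewrite expgS !invgM invgK !mulgA mulgVK.
rewrite -(mdist_act actX) metric_sym.
have K0 := quasi_axis_ge0 ax.
have A1 := displacement1 (to := to) f y0.
have D i := displacementD_le actX f y0 i 1.
have D' i := displacementD_ge actX ax i 1.
have -> : 1056 * K = 22 * (48 * K) by lra.
have pw' i : (i <= 4)%N -> displacement to f y0 i - 12 * K <=
    d p (w .* (f ^+ i .* y0)) - d p (w .* y0) <= displacement to f y0 i + 12 * K.
  by move=> /pw; rewrite ler_norml; lra.
have pv' i : (i <= 4)%N -> displacement to f y0 i - 12 * K <=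
    d p (v .* (f ^+ i .* y0)) - d p (v .* y0) <= displacement to f y0 i + 12 * K.
  by move=> /pv; rewrite ler_norml; lra.
have A0 : displacement to f y0 0 = 0.
  by rewrite /displacement expg0 (act1 actX) mdistxx.
have lt12K (P : R) : P <= 12 * K -> P <= 48 * K by lra.
move: wv; rewrite ler_norml => /andP[wv1 wv2].
have D0 := D 0%N; have D1 := D 1%N; have D2 := D 2%N; have D3 := D 3%N.
have E0 := D' 0%N; have E1 := D' 1%N; have E2 := D' 2%N; have E3 := D' 3%N.
rewrite !addn1 in D0 D1 D2 D3 E0 E1 E2 E3.
have jE : j = 1%N \/ j = 2%N by clear -j1 j2; lia.
have j4 : (j <= 4)%N by clear -j2; lia.
have jS4 : (j.+1 <= 4)%N by clear -j2; lia.
have /andP[w1 w2] := pw' j j4; have /andP[w3 w4] := pw' j.+1 jS4.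
have vj i : d ((v * f * v^-1) .* (w .* (f ^+ j .* y0))) (v .* (f ^+ i.+1 .* y0)) =
    d (w .* (f ^+ j .* y0)) (v .* (f ^+ i .* y0)).
  rewrite -[RHS](act_isom actX (v * f * v^-1)%g) -!(actM actX).
  by congr (d _ (to _ _)); rewrite expgS !mulgA mulgVK.
apply: (shift_near_geodesic hypX (T := d y0 (f .* y0)) (p := p) (q := q)
  (U := v .* (f ^+ 0 .* y0)) (U' := v .* (f ^+ 1 .* y0))
  (V := v .* (f ^+ 3 .* y0)) (V' := v .* (f ^+ 4 .* y0))
  (y := w .* (f ^+ j .* y0))) => //.
- lra.
- by apply: lt12K; exact: gw.
- by apply: lt12K; exact: gw.
- by apply: lt12K; exact: gv.
- by apply: lt12K; exact: gv.
- by apply: lt12K; exact: gv.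
- by apply: lt12K; exact: gv.
- have := pv' 1%N isT; have := pv' 0%N isT; rewrite ler_norml.
  by move=> /andP[? ?] /andP[? ?]; lra.
- have := pv' 4%N isT; have := pv' 3%N isT; rewrite ler_norml.
  by move=> /andP[? ?] /andP[? ?]; lra.
- have /andP[v0 v1] := pv' 0%N isT.
  by case: jE w1 w2 => -> *; lra.
- have /andP[v0 v1] := pv' 3%N isT.
  by case: jE w1 w2 => -> *; lra.
- by rewrite ler_norml; case: jE w1 w2 w3 w4 => -> *; lra.
Qed.

End Hyperbolic.
End QuasiAxisOps.

Section Concatenation.
Context {R : realType} {G : groupType} {X : metricType R} {to : G -> X -> X}.
Context (delta : R).
Hypothesis actX : isometric_action to.
Hypothesis hypX : gromov_hyperbolic X delta.
Local Notation d := mdist.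
Local Notation "g .* x" := (to g%g x) (at level 40, left associativity).

Lemma concat_near (K L D : R) (Q : nat) (h h' s : G) (x p p' : X) :
  quasi_axis to K h x -> delta <= K -> 1000 * K <= L -> 0 < L ->
  d x (h .* x) <= 2 * L -> d x (s .* x) <= L -> (4 <= Q)%N ->
  D + 10 * L <= displacement to h x Q -> D + 10 * L <= displacement to h' x Q ->
  gromov_product x (h^-1 ^+ Q .* x) ((s * h' ^+ Q) .* x) <= D ->
  gromov_product x p (h ^+ Q .* x) <= K + delta ->
  gromov_product x p' (h'^-1 ^+ Q .* x) <= K + delta ->
  let u := (h ^+ Q * s * h' ^+ Q)%g in [/\
  forall j, (j <= 4)%N -> gromov_product (h ^+ j .* x) p (u .* p') <= 6 * K,
  forall j, (j <= 4)%N ->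
    `|d p (h ^+ j .* x) - d p x - displacement to h x j| <= 12 * K &
  `|d p (u .* x) - d p x - d x (u .* x)| <= 6 * K].
Proof.
move=> ax dK KL L0 hL sL Q4 hQ hQ' div start stop u.
have K0 := quasi_axis_ge0 ax; have d0 := delta_ge0 hypX x.
set b := h ^+ Q .* x in start *; set c := u .* x; set e := u .* p'.
have xb : d x b = displacement to h x Q by [].
have cE : c = h ^+ Q .* (s .* (h' ^+ Q .* x)) by rewrite /c /u !(actM actX).
have bxc : gromov_product b x c <= D.
  rewrite -(gromov_product_act actX (h ^+ Q)^-1%g) cE !(actK actX) -expVgn.
  by rewrite -(actM actX s).
have D0 : 0 <= D by apply: le_trans bxc; exact: gromov_product_ge0.
have xbc : 10 * L <= gromov_product x b c.
  by rewrite gromov_product_swap xb; lra.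
have pxc : gromov_product x p c <= K + 2 * delta.
  have -> : K + 2 * delta = K + delta + delta by lra.
  rewrite gromov_productC; rewrite gromov_productC in start.
  by apply: (gromov_transfer hypX start); lra.
have cbe : gromov_product c b e <= K + 2 * delta.
  have -> : gromov_product c b e =
      gromov_product x ((h'^-1 ^+ Q * s^-1) .* x) p'.
    rewrite -[RHS](gromov_product_act actX u) -!(actM actX).
    by rewrite /u expVgn !mulgA mulgK mulgK.
  have -> : K + 2 * delta = K + delta + delta by lra.
  rewrite gromov_productC in stop.
  apply: (gromov_transfer hypX stop).
  have := gromov_product_leD x (h'^-1 ^+ Q .* x) ((h'^-1 ^+ Q * s^-1) .* x).
  have -> : d (h'^-1 ^+ Q .* x) ((h'^-1 ^+ Q * s^-1) .* x) = d x (s .* x).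
    by rewrite (actM actX) (act_isom actX) -(mdist_act actX) metric_sym.
  have -> : d x (h'^-1 ^+ Q .* x) = displacement to h' x Q.
    exact: displacementV.
  by lra.
have bc : D + 9 * L <= d b c.
  have -> : d b c = d x (s .* (h' ^+ Q .* x)).
    by rewrite cE (act_isom actX).
  have := metric_triangle (s .* x) x (s .* (h' ^+ Q .* x)).
  rewrite (act_isom actX) -/(displacement to h' x Q) (metric_sym (s .* x)); lra.
have xce : gromov_product c x e <= K + 3 * delta.
  have -> : K + 3 * delta = K + 2 * delta + delta by lra.
  rewrite gromov_productC; rewrite gromov_productC in cbe.
  rewrite gromov_productC.
  apply: (gromov_transfer hypX (x := b)); first by rewrite gromov_productC.
  by move: bc bxc cbe KL dK K0 d0 L0 D0; clear; metric_lra.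
have xce' : 9 * L <= gromov_product x c e.
  rewrite gromov_product_swap.
  have : gromov_product x b c <= d x c.
    by rewrite gromov_productC gromov_product_swap; have := gromov_product_ge0 c x b; lra.
  lra.
have pxe : gromov_product x p e <= K + 3 * delta.
  have -> : K + 3 * delta = K + 2 * delta + delta by lra.
  rewrite gromov_productC; rewrite gromov_productC in pxc.
  by apply: (gromov_transfer hypX pxc); lra.
have xbe : 8 * L <= gromov_product x b e.
  by have := gromov_ineq hypX x b c e; lra.
have Aj j : (j <= 4)%N -> displacement to h x j <= 8 * L.
  move=> j4; apply: le_trans (displacement_le actX h x j) _.
  have -> : 8 * L = 4%:R * (2 * L) by lra.
  by apply: ler_pM; rewrite ?ler_nat // ?mdist_ge0.
have near_xe j : (j <= 4)%N -> gromov_product (h ^+ j .* x) x e <= K + delta.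
  move=> j4; apply: (near_geodesic_fork hypX (b := b)).
    have := @quasi_axis_between _ _ _ _ actX _ _ _ ax 0 j Q.
    by rewrite expg0 (act1 actX) leq0n (leq_trans j4 Q4) => /(_ isT).
  by apply: le_trans xbe; exact: Aj.
split=> [j j4|j j4|].
- have := near_xe j j4; have := metric_triangle p x (h ^+ j .* x).
  by move: pxe dK d0 K0; clear; metric_lra.
- have := near_xe j j4; have := metric_triangle p x (h ^+ j .* x).
  have := metric_triangle p (h ^+ j .* x) e.
  rewrite ler_norml -/(displacement to h x j) /displacement.
  by move: pxe dK d0 K0; clear; metric_lra.
- have := metric_triangle p x c; rewrite ler_norml.
  by move: pxc dK d0 K0; clear; metric_lra.
Qed.

End Concatenation.

Lemma commute_conj_pair (G : groupType) (zeta h s h' : G) (Q : nat) :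
  let u := (h ^+ Q * s * h' ^+ Q)%g in
  commute zeta h -> commute zeta (u * h'^-1 * u^-1)%g ->
  commute zeta (s * h' * s^-1)%g.
Proof.
move=> u zh zk.
have -> : (s * h' * s^-1 = (h ^+ Q)^-1 * (u * h'^-1 * u^-1)^-1 * h ^+ Q)%g.
  rewrite /u !invgM !invgK !mulgA mulgVK mulVg mul1g.
  rewrite -expVgn -!mulgA; congr (s * _)%g; rewrite !mulgA -expgSr expgS.
  by rewrite -!mulgA (mulgA (h' ^+ Q)%g) expVgn mulgV mul1g.
apply: commuteM; last exact: commuteX.
by apply: commuteM; apply: commuteV => //; exact: commuteX.
Qed.

Section CommonCentralizer.
Context {R : realType} {G : groupType} {X : metricType R} {to : G -> X -> X}.
Context (delta : R).
Hypothesis actX : isometric_action to.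
Hypothesis hypX : gromov_hyperbolic X delta.
Local Notation d := mdist.
Local Notation "g .* x" := (to g%g x) (at level 40, left associativity).

Lemma common_centralizer_displacement (K D L : R) (Q : nat) (g s zeta : G) (x : X) :
  quasi_axis to K g x -> delta <= K -> 2 * K < d x (g .* x) -> K <= D ->
  d x (s .* x) <= L -> D + L + 10 * K < displacement to g x Q ->
  gromov_product x (g ^+ Q .* x) ((s * g ^+ Q) .* x) <= D ->
  gromov_product x (g^-1 ^+ Q .* x) ((s * g ^+ Q) .* x) <= D ->
  commute zeta g -> commute zeta (s * g * s^-1)%g ->
  d x (zeta .* x) <= 2 * K + 30 * delta.
Proof.
move=> ax dK gx KD sL gQ divp divm zg zs.
have K0 := quasi_axis_ge0 ax; have d0 := delta_ge0 hypX x.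
have axV := quasi_axisV ax.
have L0 : 0 <= L by apply: le_trans sL; exact: mdist_ge0.
pose tau := d x (zeta .* x) + d (s .* x) (zeta .* (s .* x)).
have tau1 := mdist_ge0 x (zeta .* x).
have tau2 := mdist_ge0 (s .* x) (zeta .* (s .* x)).
have [N hN] := axis_ray_far actX ax gx
  (4 * (D + 2 * delta) + 4 * tau + 4 * delta + L + 1).
pose n := maxn N Q; have Nn : (N <= n)%N := leq_maxl _ _.
have Qn : (Q <= n)%N := leq_maxr _ _.
have farp := hN true n Nn; have farm := hN false n Nn; rewrite /= in farp farm.
have along f : quasi_axis to K f x -> displacement to f x Q = displacement to g x Q ->
    D + L + 9 * K < gromov_product x (f ^+ Q .* x) (f ^+ n .* x).
  move=> axf fQ; rewrite gromov_product_swap -/(displacement to f x Q) fQ.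
  have := quasi_axis_between actX axf (i := 0) (j := Q) (k := n).
  by rewrite leq0n Qn expg0 (act1 actX) => /(_ isT); lra.
have alongs : D + 9 * K < gromov_product x ((s * g ^+ Q) .* x) ((s * g ^+ n) .* x).
  have := along g ax erefl; rewrite -(gromov_product_act actX s) -!(actM actX).
  have := gromov_product_base (s .* x) x ((s * g ^+ Q) .* x) ((s * g ^+ n) .* x).
  by rewrite (metric_sym _ x); lra.
have div f : quasi_axis to K f x -> displacement to f x Q = displacement to g x Q ->
    gromov_product x (f ^+ Q .* x) ((s * g ^+ Q) .* x) <= D ->
    gromov_product x (f ^+ n .* x) ((s * g ^+ n) .* x) <= D + 2 * delta.
  move=> axf fQ fD; have := along f axf fQ.
  have := gromov_ineq hypX x (f ^+ Q .* x) (f ^+ n .* x) ((s * g ^+ Q) .* x).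
  have := gromov_ineq hypX x (f ^+ n .* x) ((s * g ^+ n) .* x) ((s * g ^+ Q) .* x).
  by rewrite (gromov_productC x ((s * g ^+ n) .* x)); lra.
have moved f : commute zeta f -> d (f ^+ n .* x) (zeta .* (f ^+ n .* x)) = d x (zeta .* x).
  move=> zf; rewrite -(actM actX) (commuteX n zf) (actM actX).
  by rewrite (act_isom actX).
apply: (three_ends hypX (f := to zeta) (x := x) (D := D + 2 * delta) (tau := tau)
  (P1 := g^-1 ^+ n .* x) (P2 := g ^+ n .* x) (P3 := (s * g ^+ n) .* x)).
- by move=> y z; rewrite (act_isom actX).
- exact: ax.
- by apply: div => //; exact: displacementV.
- exact: div.
- by lra.
- by rewrite /tau; lra.
- by rewrite moved; [rewrite /tau; lra | exact: commuteV].
- by rewrite moved //; rewrite /tau; lra.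
- have -> : d ((s * g ^+ n) .* x) (zeta .* ((s * g ^+ n) .* x)) =
      d (s .* x) (zeta .* (s .* x)).
    have -> : (s * g ^+ n = s * g ^+ n * s^-1 * s)%g by rewrite mulgVK.
    rewrite conj_expg !(actM actX _ s) -(actM actX zeta) (commuteX n zs).
    by rewrite (actM actX _ zeta) (act_isom actX).
  by rewrite /tau; lra.
- by lra.
- by lra.
- have := metric_triangle (s .* x) x ((s * g ^+ n) .* x).
  rewrite {1}(actM actX s) (act_isom actX) (metric_sym _ x); lra.
Qed.

Lemma diverging_generator (K L r eps : R) (N Q : nat) (g : G) (S : set G) (x : X) :
  ~ elementary to -> finite_generating_set S ->
  (forall y z, r <= d y z ->
    [set g | d y (g .* y) <= eps /\ d z (g .* z) <= eps] #<= `I_N) ->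
  quasi_axis to K g x -> delta <= K -> (forall s, S s -> d x (s .* x) <= L) ->
  1000 * K <= L -> 0 < L ->
  L - 3 * K <= d x (g .* x) -> d x (g .* x) <= 2 * L -> r <= d x (g .* x) ->
  88 * K <= eps -> (N + 8 <= Q)%N ->
  exists2 s, S s & forall e e' : bool,
    gromov_product x ((if e then g else g^-1) ^+ Q .* x)
      ((s * (if e' then g else g^-1) ^+ Q) .* x) <= (2 * N + 17)%:R * L.
Proof.
move=> nonelem [_ _ genS] acyl ax dK SL KL L0 gL gL2 rg Keps NQ.
apply: contrapT => nodiv; apply: nonelem.
have K0 := quasi_axis_ge0 ax.
have axe e : quasi_axis to K (if e then g else g^-1)%g x.
  by case: e => //; exact: quasi_axisV.
have de e n : displacement to (if e then g else g^-1)%g x n = displacement to g x n.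
  by case: e => //; exact: displacementV.
have de1 e : d x ((if e then g else g^-1) .* x) = d x (g .* x).
  by have := de e 1%N; rewrite !displacement1.
pose f := (g ^+ (N`!))%g.
have fS s : S s -> exists e : bool, (s * f * s^-1)%g = if e then f else f^-1%g.
  move=> Ss.
  have [e [e' ovl]] : exists e e' : bool, (2 * N + 17)%:R * L <=
      gromov_product x ((if e then g else g^-1) ^+ Q .* x)
        ((s * (if e' then g else g^-1) ^+ Q) .* x).
    apply: contrapT => no; apply: nodiv; exists s => // e e'.
    by apply/ltW; rewrite ltNge; apply/negP => le; apply: no; exists e, e'.
  have dee n : displacement to (if e' then g else g^-1)%g x n =
      displacement to (if e then g else g^-1)%g x n by rewrite !de.
  have ga : L - 3 * K <= d x ((if e then g else g^-1) .* x) by rewrite de1.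
  have gb : d x ((if e then g else g^-1) .* x) <= 2 * L by rewrite de1.
  have gc : r <= d x ((if e then g else g^-1) .* x) by rewrite de1.
  have [m /andP[m0 mN]] := axis_overlap actX hypX acyl (axe e) (axe e') dee dK
    (SL s Ss) KL L0 ga gb gc Keps NQ ovl.
  have mf : (m %| N`!)%N by apply: dvdn_fact; rewrite m0.
  move: mf => /dvdnP[k fE]; rewrite conj_expg => /(congr1 (fun a => a ^+ k)%g).
  rewrite -!expgnA mulnC -fE -conj_expg => sf.
  have eX (b : bool) n : ((if b then g else g^-1) ^+ n = if b then g ^+ n else (g ^+ n)^-1)%g.
    by case: b => //; rewrite expVgn.
  move: sf; rewrite !eX -/f => sf.
  have sV : (s * f^-1 * s^-1 = (s * f * s^-1)^-1)%g by rewrite !invgM invgK mulgA.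
  exists (e == e'); case: e' {ovl dee} sf; case: e {ga gb gc} => //=; rewrite sV => sf.
    by rewrite -[LHS]invgK sf.
  by apply: invg_inj.
have fG k : exists e : bool, (k * f * k^-1)%g = if e then f else f^-1%g.
  have : (\bigcup_n word_ball S n) k by rewrite genS.
  move=> [n _]; apply: (word_ball_closed
    (P := [set k | exists e : bool, (k * f * k^-1)%g = if e then f else f^-1%g])).
    by exists true; rewrite mul1g invg1 mulg1.
  move=> s h Ss [e he] /=; have [e' hs] := fS s Ss.
  have -> : (s * h * f * (s * h)^-1 = s * (h * f * h^-1) * s^-1)%g.
    by rewrite invgM !mulgA.
  rewrite he; case: e {he}; first by exists e'.
  exists (~~ e'); have -> : (s * f^-1 * s^-1 = (s * f * s^-1)^-1)%g.
    by rewrite !invgM invgK mulgA.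
  by rewrite hs; case: e' {hs}; rewrite ?invgK.
apply: (elementary_of_normal_axis actX hypX (K := K) (f := f) (x := x)).
- exact: quasi_axisX.
- have := displacement_lb actX ax _ (fact_gt0 N); rewrite mul1r.
  by rewrite /displacement -/f; lra.
- by move=> k; have [[] ->] := fG k; [left|right].
Qed.

End CommonCentralizer.

Lemma commute_of_twist (G : groupType) (z z0 f : G) :
  (z * f * z^-1 * f^-1 = z0 * f * z0^-1 * f^-1)%g -> commute (z0^-1 * z)%g f.
Proof.
move=> /(@mulIg _ _) e; rewrite /commute.
have zf : (z * f = z0 * f * z0^-1 * z)%g by rewrite -e mulgVK.
by rewrite -mulgA zf -!mulgA mulKg.
Qed.

Section Separators.
Context {R : realType} {G : groupType} {X : metricType R} {to : G -> X -> X}.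
Context (delta : R).
Hypothesis actX : isometric_action to.
Hypothesis hypX : gromov_hyperbolic X delta.
Local Notation d := mdist.
Local Notation "g .* x" := (to g%g x) (at level 40, left associativity).

Definition signed (g : G) (e : bool) : G := (if e then g else g^-1)%g.

Definition separator (g s : G) (Q : nat) (e e' : bool) : G :=
  (signed g e ^+ Q * s * signed g e' ^+ Q)%g.

Record separating (K L r eps : R) (N Q : nat) (g s : G) (x : X) : Prop := Separating {
  sep_axis : quasi_axis to K g x;
  sep_deltaK : delta <= K;
  sep_KL : 1000 * K <= L;
  sep_L : 0 < L;
  sep_ga : L - 3 * K <= d x (g .* x);
  sep_gL : d x (g .* x) <= 2 * L;
  sep_r : r <= d x (g .* x);
  sep_eps : 1056 * K <= eps;
  sep_acyl : forall y z, r <= d y z ->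
    [set a | d y (a .* y) <= eps /\ d z (a .* z) <= eps] #<= `I_N;
  sep_s : d x (s .* x) <= L;
  sep_Q : (N + 8 <= Q)%N;
  sep_far : (2 * N + 17)%:R * L + 20 * L <= displacement to g x Q;
  sep_div : forall e e', gromov_product x (signed g e ^+ Q .* x)
      ((s * signed g e' ^+ Q) .* x) <= (2 * N + 17)%:R * L }.

Lemma signedV g e : ((signed g e)^-1 = signed g (~~ e))%g.
Proof. by case: e; rewrite //= /signed invgK. Qed.

Lemma quasi_axis_signed K g x e : quasi_axis to K g x ->
  quasi_axis to K (signed g e) x.
Proof. by case: e => //; exact: quasi_axisV. Qed.

Lemma displacement_signed g x e n :
  displacement to (signed g e) x n = displacement to g x n.
Proof. by case: e => //; exact: displacementV. Qed.

Lemma mdist_signed g x e : d x (signed g e .* x) = d x (g .* x).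
Proof. by have := displacement_signed g x e 1; rewrite !displacement1. Qed.

Section Data.
Context (K L r eps : R) (N Q : nat) (g s : G) (x : X).
Hypothesis sep : separating K L r eps N Q g s x.

Lemma sign_away p : exists e, gromov_product x p (signed g e ^+ Q .* x) <= K + delta.
Proof.
case: sep => ax *.
have := gromov_ineq hypX x (signed g false ^+ Q .* x) p (signed g true ^+ Q .* x).
rewrite [gromov_product x (signed g false ^+ Q .* x) p]gromov_productC.
have := ax Q Q; rewrite -/(signed g false) -/(signed g true).
by move=> a [b|b]; [exists false|exists true]; lra.
Qed.

(* The four points w h^j x at the beginning, and w u h'^-j x at the end, of the
   translate by w of the separator u all lie close to a geodesic from x to
   w u w' x. *)
Definition marked (Gx : X) (w : G) (e e' : bool) : Prop :=
  let h := signed g e in let u := separator g s Q e e' in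
  let k := (u * (signed g e')^-1 * u^-1)%g in
  [/\ forall j, (j <= 4)%N -> gromov_product (w .* (h ^+ j .* x)) x Gx <= 12 * K,
   forall j, (j <= 4)%N -> `|d x (w .* (h ^+ j .* x)) - d x (w .* x) -
     displacement to h x j| <= 12 * K,
   forall j, (j <= 4)%N ->
     gromov_product (w .* (k ^+ j .* (u .* x))) Gx x <= 12 * K,
   forall j, (j <= 4)%N -> `|d Gx (w .* (k ^+ j .* (u .* x))) -
     d Gx (w .* (u .* x)) - displacement to k (u .* x) j| <= 12 * K &
   `|d Gx (w .* (u .* x)) - (d x Gx - d x (w .* x) - d x (u .* x))| <= 30 * K].

Lemma separator_marked (w w' : G) (e e' : bool) :
  gromov_product x (w^-1 .* x) (signed g e ^+ Q .* x) <= K + delta ->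
  gromov_product x (w' .* x) ((signed g e')^-1 ^+ Q .* x) <= K + delta ->
  marked ((w * separator g s Q e e' * w') .* x) w e e'.
Proof.
case: sep => ax dK KL L0 ga gL rg _ acyl sL QN far div start stop.
set h := signed g e; set h' := signed g e'; set u := separator g s Q e e'.
set Gx := (w * u * w') .* x => /=.
have K0 := quasi_axis_ge0 ax.
pose D := (2 * N + 17)%:R * L + L.
have Q4 : (4 <= Q)%N by clear -QN; lia.
have GxE : Gx = w .* (u .* (w' .* x)).
  by rewrite /Gx (actM actX _ w') (actM actX w).
have fwd y : gromov_product y (w^-1 .* x) (u .* (w' .* x)) =
    gromov_product (w .* y) x Gx.
  by rewrite -(gromov_product_act actX w) (actKV actX) GxE.
have bwd y : gromov_product y (w' .* x) (u^-1 .* (w^-1 .* x)) =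
    gromov_product (w .* (u .* y)) Gx x.
  by rewrite -(gromov_product_act actX (w * u)%g) !(actM actX w u) !(actKV actX) GxE.
have fwd_d y : d (w^-1 .* x) y = d x (w .* y).
  by rewrite (mdist_act actX) invgK.
have bwd_d y : d (w' .* x) y = d Gx (w .* (u .* y)).
  by rewrite GxE !(act_isom actX).
have aE : d x (h .* x) <= 2 * L by rewrite mdist_signed.
have a'E : d x (h'^-1 .* x) <= 2 * L by rewrite signedV mdist_signed.
have sVL : d x (s^-1 .* x) <= L by rewrite -(mdist_act actX) metric_sym.
have farD e1 : D + 10 * L <= displacement to (signed g e1) x Q.
  by rewrite displacement_signed /D; lra.
have div1 : gromov_product x (h^-1 ^+ Q .* x) ((s * h' ^+ Q) .* x) <= D.
  by rewrite signedV; apply: le_trans (div _ _) _; rewrite /D; lra.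
have div2 : gromov_product x (h'^-1^-1 ^+ Q .* x) ((s^-1 * h^-1 ^+ Q) .* x) <= D.
  rewrite invgK -(gromov_product_act actX s) -!(actM actX) mulVKg.
  have := gromov_product_base (s .* x) x ((s * h' ^+ Q) .* x) (h^-1 ^+ Q .* x).
  rewrite (metric_sym _ x) (gromov_productC x) signedV.
  by have := div (~~ e) e'; rewrite /D -/h'; lra.
have stop2 : gromov_product x (w^-1 .* x) (h^-1^-1 ^+ Q .* x) <= K + delta.
  by rewrite invgK.
have ax1 : quasi_axis to K h x by exact: quasi_axis_signed.
have ax2 : quasi_axis to K h'^-1%g x by rewrite signedV; exact: quasi_axis_signed.
have f1 := farD e; have f2 := farD e'.
have f3 : D + 10 * L <= displacement to h'^-1%g x Q by rewrite signedV.
have f4 : D + 10 * L <= displacement to h^-1%g x Q by rewrite signedV.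
have [n1 s1 t1] := concat_near actX hypX ax1 dK KL L0 aE sL Q4 f1 f2 div1 start stop.
have [n2 s2 t2] := concat_near actX hypX ax2 dK KL L0 a'E sVL Q4 f3 f4 div2 stop stop2.
rewrite -/(separator g s Q e e') -/u in n1 t1.
have uV : (h'^-1 ^+ Q * s^-1 * h^-1 ^+ Q = u^-1)%g.
  by rewrite /u /separator !invgM !expVgn mulgA.
rewrite uV in n2 t2.
have kE j : (u * h'^-1 * u^-1) ^+ j .* (u .* x) = u .* (h'^-1 ^+ j .* x).
  exact: act_conj_expg.
split=> [j j4|j j4|j j4|j j4|].
- by have := n1 j j4; rewrite fwd; lra.
- by have := s1 j j4; rewrite !fwd_d.
- by rewrite kE -bwd; have := n2 j j4; lra.
- by rewrite kE displacement_conj //; have := s2 j j4; rewrite !bwd_d.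
- have := n2 0%N isT; rewrite expg0 (act1 actX) bwd.
  have := gromov_product_ge0 (w .* (u .* x)) Gx x.
  by move: t1; rewrite !fwd_d !ler_norml; clear -K0; metric_lra.
Qed.

End Data.
End Separators.

Arguments separating {R G X} to delta K L r eps N Q g s x.
Arguments marked {R G X} to K Q g s x Gx w e e'.

Section SeparatorCount.
Context {R : realType} {G : groupType} {X : metricType R} {to : G -> X -> X}.
Context (delta : R).
Hypothesis actX : isometric_action to.
Hypothesis hypX : gromov_hyperbolic X delta.
Local Notation d := mdist.
Local Notation "g .* x" := (to g%g x) (at level 40, left associativity).

Lemma separating_centralizer (K L r eps : R) (N Q : nat) (g s zeta : G) (x : X)
    (e e' : bool) : separating to delta K L r eps N Q g s x ->
  commute zeta (signed g e) ->
  commute zeta (separator g s Q e e' * (signed g e')^-1 * (separator g s Q e e')^-1)%g ->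
  d x (zeta .* x) <= eps.
Proof.
case=> ax dK KL L0 ga gL rg Keps acyl sL QN far div zh zk.
have K0 := quasi_axis_ge0 ax.
have unsign f a : commute zeta (f * signed g a * f^-1)%g ->
    commute zeta (f * g * f^-1)%g.
  case: a => //= c; have -> : (f * g * f^-1 = (f * g^-1 * f^-1)^-1)%g.
    by rewrite !invgM !invgK mulgA.
  exact: commuteV.
have zg : commute zeta g.
  by have := @unsign 1%g e; rewrite invg1 !mulg1 !mul1g; apply.
have zs := unsign s e' (commute_conj_pair zh zk).
have N0 : 0 <= N%:R * L by rewrite mulr_ge0 // ltW.
have NE : (2 * N + 17)%:R = 2 * N%:R + 17 :> R by rewrite natrD natrM.
rewrite NE in far div.
have h1 : 2 * K < d x (g .* x) by lra.
have h2 : K <= (2 * N%:R + 17) * L by lra.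
have h3 : (2 * N%:R + 17) * L + L + 10 * K < displacement to g x Q by lra.
have := common_centralizer_displacement actX hypX ax dK h1 h2 sL h3
  (div true true) (div false true) zg zs.
by have := delta_ge0 hypX x; lra.
Qed.

Lemma separator_fiber (K L r eps : R) (N Q : nat) (g s : G) (x Gx : X)
    (e e' : bool) (V : set G) : finite_set V ->
  separating to delta K L r eps N Q g s x ->
  (forall w, V w -> marked to K Q g s x Gx w e e') ->
  (forall w v, V w -> V v -> `|d x (w .* x) - d x (v .* x)| <= L / 4) ->
  (ncard V <= N * (N * N))%N.
Proof.
move=> Vfin sep mark near_pos.
have [->|/set0P[w0 Vw0]] := eqVneq V set0; first by rewrite /ncard fset_set0 cardfs0.
have [ax dK KL L0 ga gL rg Keps acyl sL QN far div] := sep.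
have K0 := quasi_axis_ge0 ax.
set h := signed g e in mark; set u := separator g s Q e e'.
pose k := (u * (signed g e')^-1 * u^-1)%g.
have axh : quasi_axis to K h x by exact: quasi_axis_signed.
have axk : quasi_axis to K k (u .* x).
  by apply: quasi_axis_conj => //; rewrite signedV; exact: quasi_axis_signed.
have hd : d x (h .* x) = d x (g .* x) by exact: mdist_signed.
have kd : d (u .* x) (k .* (u .* x)) = d x (g .* x).
  by rewrite -displacement1 displacement_conj // signedV displacement1 mdist_signed.
pose c f w := (w0^-1 * w * f * (w0^-1 * w)^-1 * f^-1)%g.
pose T f y0 := [set a | d (f ^+ 2 .* y0) (a .* (f ^+ 2 .* y0)) <= eps /\
                        d (f ^+ 3 .* y0) (a .* (f ^+ 3 .* y0)) <= eps].
have TN f y0 : d y0 (f .* y0) = d x (g .* x) -> T f y0 #<= `I_N.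
  move=> fE; apply: acyl.
  by rewrite -[3%N]addn1 mdist_orbit // displacement1 fE.
have ch w : V w -> T h x (c h w).
  move=> Vw; have [m1 m2 _ _ _] := mark w0 Vw0; have [v1 v2 _ _ _] := mark w Vw.
  have sa : L / 4 + 100 * K <= d x (h .* x) by rewrite hd; lra.
  have tw := twist_displacement actX hypX dK axh m1 v1 m2 v2 (near_pos w0 w Vw0 Vw) sa.
  by split; apply: le_trans Keps; exact: tw.
have ck w : V w -> T k (u .* x) (c k w).
  move=> Vw; have [_ _ m1 m2 m3] := mark w0 Vw0; have [_ _ v1 v2 v3] := mark w Vw.
  have sa : L / 4 + 60 * K + 100 * K <= d (u .* x) (k .* (u .* x)) by rewrite kd; lra.
  have pos : `|d Gx (w0 .* (u .* x)) - d Gx (w .* (u .* x))| <= L / 4 + 60 * K.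
    have := near_pos w0 w Vw0 Vw; move: m3 v3; rewrite -/u !ler_norml.
    by clear; lra.
  have tw := twist_displacement actX hypX dK axk m1 v1 m2 v2 pos sa.
  by split; apply: le_trans Keps; exact: tw.
have Tfin f y0 : d y0 (f .* y0) = d x (g .* x) -> finite_set (T f y0).
  by move=> fE; apply: card_le_finite (TN f y0 fE) (finite_II N).
apply: (@leq_trans (N * ncard (T h x `*` T k (u .* x)))); last first.
  rewrite leq_mul2l ncard_setX; [|exact: Tfin..].
  by apply/orP; right; apply: leq_mul; apply: geq_card_fset_set; exact: TN.
apply: (ncard_fibers (f := fun w => (c h w, c k w))) => //.
- by apply: finite_setX; exact: Tfin.
- by move=> w Vw; split; [exact: ch|exact: ck].
move=> [c1 c2] _; set F := V `&` _.
have Ffin : finite_set F by exact: finite_setIl.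
have [->|/set0P[v0 [Vv0 [v01 v02]]]] := eqVneq F set0.
  by rewrite /ncard fset_set0 cardfs0.
pose Z := [set a | d x (a .* x) <= eps /\ d (g .* x) (a .* (g .* x)) <= eps].
have ZN : Z #<= `I_N by exact: acyl.
apply: leq_trans (geq_card_fset_set ZN).
apply: (ncard_inj (f := fun w => (v0^-1 * w)%g)) => //.
- by apply: card_le_finite ZN (finite_II N).
- by move=> a b _ _; exact: mulgI.
move=> w [Vw [w1 w2]].
have z0z : (v0^-1 * w = (w0^-1 * v0)^-1 * (w0^-1 * w))%g.
  by rewrite invgM invgK -mulgA mulVKg.
have zh : commute (v0^-1 * w)%g h.
  by rewrite z0z; apply: commute_of_twist; rewrite -[LHS]/(c h w) w1 -v01.
have zk : commute (v0^-1 * w)%g k.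
  by rewrite z0z; apply: commute_of_twist; rewrite -[LHS]/(c k w) w2 -v02.
have small := separating_centralizer sep zh zk.
have zg : commute (v0^-1 * w)%g g.
  by move: zh; rewrite /h /signed; case: (e) => // /commuteV; rewrite invgK.
by split=> //; rewrite -(actM actX (v0^-1 * w)%g g) zg (actM actX g) act_isom.
Qed.

Lemma ball_product_bound (K L r eps : R) (N Q cg : nat) (g s : G) (S : set G) (x : X) :
  finite_generating_set S -> (forall t, S t -> d x (t .* x) <= L) -> S s ->
  separating to delta K L r eps N Q g s x -> word_ball S cg g ->
  forall m n, (ncard (word_ball S m) * ncard (word_ball S n) <=
    N * (N * N) * (16 * m.+1) * ncard (word_ball S (m + n + (Q * cg + 1 + Q * cg))))%N.
Proof.
move=> [Sfin SV _] SL Ss sep cgg m n.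
have [ax dK KL L0 ga gL rg Keps acyl sL QN far div] := sep.
have [sg hsg] := choice (fun w => sign_away hypX sep (w^-1 .* x)).
have [sg' hsg'] := choice (fun w => sign_away hypX sep (w .* x)).
pose u w w' := separator g s Q (sg w) (~~ sg' w').
pose bucket w := Num.truncn (4 * d x (w .* x) / L).
pose Phi (p : G * G) : G * (bool * bool * nat) :=
  ((p.1 * u p.1 p.2 * p.2)%g, (sg p.1, ~~ sg' p.2, bucket p.1)).
set c := (Q * cg + 1 + Q * cg)%N.
have ballfin i : finite_set (word_ball S i) by exact: word_ball_finite.
have signed_ball e : word_ball S (Q * cg) (signed g e ^+ Q)%g.
  by apply: word_ballX; case: e => //=; exact: word_ballV.
have disp i w : word_ball S i w -> d x (w .* x) <= i%:R * L.
  move=> [v [vi vS] <-]; apply: (@le_trans _ _ ((size v)%:R * L)); last first.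
    by rewrite ler_wpM2r ?ler_nat // ltW.
  elim: v vS {vi} => [|t v IH] vS; first by rewrite big_nil (act1 actX) mdistxx mul0r.
  rewrite big_cons (actM actX) /=.
  have := metric_triangle x (t .* x) (t .* ((\prod_(j <- v) j) .* x)).
  rewrite act_isom // -natr1 mulrDl mul1r.
  have := SL t (vS t (mem_head _ _)).
  have := IH (fun y yv => vS y (mem_behead (s := t :: v) yv)); lra.
pose B : set (G * (bool * bool * nat)) :=
  word_ball S (m + n + c) `*` (setT `*` `I_(4 * m).+1).
have Bfin : finite_set B.
  by apply: finite_setX => //; apply: finite_setX => //; exact: finite_finset.
rewrite -ncard_setX //; apply: (@leq_trans (N * (N * N) * ncard B)); last first.
  rewrite -[leqRHS]mulnA leq_mul2l; apply/orP; right.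
  rewrite /B ncard_setX //; last by apply: finite_setX => //; exact: finite_finset.
  rewrite ncard_setX //; last exact: finite_finset.
  rewrite ncard_II mulnC leq_mul2r; apply/orP; right.
  have : (ncard [set: bool * bool] <= 4)%N.
    rewrite -[leqRHS](ncard_II 4).
    apply: (@ncard_inj _ _ _ `I_4 (fun p : bool * bool => p.1 + p.2.*2)%N).
    - exact: finite_II.
    - by move=> [[] []] [[] []].
    - by move=> [[] []].
    - exact: finite_finset.
  move=> le4; apply: leq_trans (leq_mul le4 (leqnn _)) _.
  by clear; lia.
apply: (ncard_fibers (f := Phi)) => //.
- exact: finite_setX.
- move=> [w w'] [/= wm w'n]; split=> /=; last first.
    split=> //=; rewrite ltnS truncn_le_nat.
    have -> : (4 * m).+1%:R = 4 * m%:R + 1 :> R by rewrite -natr1 natrM.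
    by rewrite ltr_pdivrMr //; have := disp m w wm; lra.
  have -> : (m + n + c = m + c + n)%N by rewrite addnAC.
  by do 4?apply: word_ballM => //; exact: word_ball_gen.
move=> [Gam [[e e'] b]] _; set F := _ `&` _.
have Ffin : finite_set F by apply: finite_setIl; exact: finite_setX.
pose V := [set w | exists w', F (w, w')].
have Vfin : finite_set V.
  apply: sub_finite_set (ballfin m); move=> w [w' [[]]] //.
apply: (@leq_trans (ncard V)).
  apply: (ncard_inj (f := fst)) => //.
    move=> [w w'] [v v']; rewrite !inE => -[_ [p1 p2 p3 _]] [_ [q1 q2 q3 _]] /= wv.
    move: p1 q1; rewrite /u p2 q2 p3 q3 wv => <- /(@mulgI _ _) e0.
    by congr pair.
  by move=> [w w'] Fw; exists w'.
apply: (separator_fiber (x := x) (Gx := Gam .* x) (e := e) (e' := e') Vfin sep).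
  move=> w [w' [_ [p1 p2 p3 _]]].
  rewrite -p1 /u -p2 -p3; apply: (separator_marked actX hypX sep); first exact: hsg.
  by rewrite signedV negbK; exact: hsg'.
move=> w v [w' [_ [_ _ _ bw]]] [v' [_ [_ _ _ bv]]].
have trunc y : bucket y = b -> b%:R <= 4 * d x (y .* x) / L < b%:R + 1.
  move=> <-; rewrite natr1; apply: truncn_itv.
  by rewrite divr_ge0 ?mulr_ge0 ?mdist_ge0 // ltW.
have /andP[w1 w2] := trunc w bw; have /andP[v1 v2] := trunc v bv.
move: w1 w2 v1 v2; do 2![rewrite ler_pdivlMr // ltr_pdivrMr // => ? ?].
by rewrite ler_norml; lra.
Qed.

End SeparatorCount.

(** * Supermultiplicativity of balls *)

Section Supermultiplicativity.
Context {R : realType} {G : groupType} {X : metricType R} {to : G -> X -> X}.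
Local Notation d := mdist.
Local Notation "g .* x" := (to g%g x) (at level 40, left associativity).

Lemma ball_supermultiplicative (delta : R) :
  finitely_generated G -> hyperbolic_space X delta -> isometric_action to ->
  acylindrical to -> ~ elementary to ->
  (exists M : nat, forall S : set G, finite_generating_set S ->
     exists g : G, word_ball S M g /\ hyperbolic_element to g) ->
  exists C c : nat, forall S : set G, finite_generating_set S -> forall m n,
    (ncard (word_ball S m) * ncard (word_ball S n) <=
     C * m.+1 * ncard (word_ball S (m + n + c)))%N.
Proof.
move=> [S0 genS0] [geoX hypX] actX acylX nonelem [M hypM].
have [_ [_ [x0 _]]] := hypM S0 genS0.
have d0 := delta_ge0 hypX x0.
pose K := 9 * delta + 1; pose eps := 1056 * K.
have eps0 : 0 < eps by rewrite /eps /K; lra.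
have [r [N [r0 _ acyl]]] := acylX eps eps0.
pose B := 1003 * K + r.
have B0 : 0 < B by rewrite /B /K; lra.
have [N1 big] := acylindrical_power_displacement actX acylX B0.
pose c0 := (N1 * M).+1; pose Q := (2 * (2 * N + 37))%N.
pose c := (Q * (c0 + c0) + 1 + Q * (c0 + c0))%N.
exists (N * (N * N) * 16)%N, c => S genS m n.
have [Sfin SV _] := genS.
have [h [hM hh]] := hypM S genS.
have Fbig y : exists2 s, word_ball S c0 s & B < d y (s .* y).
  have [i iN By] := big h hh y; exists (h ^+ i)%g => //.
  by apply: (word_ball_sub (leqW (leq_mul iN (leqnn M)))); exact: word_ballX.
have Ffin : finite_set (word_ball S c0) by exact: word_ball_finite.
have FV s : word_ball S c0 s -> word_ball S c0 s^-1%g by exact: word_ballV.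
have B20 : 20 * delta + 20 <= B by rewrite /B /K; lra.
have [x [L [g [BL xL gF gL gk]]]] :=
  large_displacement actX geoX hypX x0 Ffin FV Fbig B20.
have SL s : S s -> d x (s .* x) <= L.
  move=> Ss; apply: xL; apply: (@word_ball_sub _ _ 1) => //; exact: word_ball_gen.
have ball_g : word_ball S (c0 + c0) g.
  case: gF => [Fg|[s [t [Fs Ft ->]]]]; last exact: word_ballM.
  by apply: word_ball_sub Fg; rewrite leq_addr.
have g2L : d x (g .* x) <= 2 * L.
  case: gF => [Fg|[s [t [Fs Ft ->]]]].
    by have := xL g Fg; move: BL B0; lra.
  rewrite (actM actX); have := metric_triangle x (s .* x) (s .* (t .* x)).
  by rewrite (act_isom actX); have := xL s Fs; have := xL t Ft; lra.
have ax : quasi_axis to K g x.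
  have -> : K = 7 * delta + 1 + 2 * delta by rewrite /K; lra.
  by apply: (quasi_axis_of_step actX hypX gk); move: BL; rewrite /B /K; lra.
have dK : delta <= K by rewrite /K; lra.
have KL : 1000 * K <= L by move: BL; rewrite /B /K; lra.
have L0 : 0 < L by lra.
have ga : L - 3 * K <= d x (g .* x) by rewrite /K; lra.
have rg : r <= d x (g .* x) by move: BL ga; rewrite /B; lra.
have Keps : 88 * K <= eps by rewrite /eps; move: dK; lra.
have NQ : (N + 8 <= Q)%N by rewrite /Q; clear; lia.
have [s Ss div] := diverging_generator actX hypX nonelem genS acyl ax dK SL KL L0
  ga g2L rg Keps NQ.
rewrite -[(_ * 16 * _)%N]mulnA.
apply: (ball_product_bound actX hypX (K := K) (L := L) (r := r) (eps := eps)
  (g := g) (s := s) (x := x)) => //.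
split=> //; first exact: SL.
apply: le_trans (displacement_ge actX ax Q).
have -> : (2 * N + 17)%:R = 2 * N%:R + 17 :> R by rewrite natrD natrM.
have -> : Q%:R = 2 * (2 * N%:R + 37) :> R by rewrite natrM natrD natrM.
have le2 : L / 2 <= d x (g .* x) - 2 * K by lra.
have -> : (2 * N%:R + 17) * L + 20 * L = 2 * (2 * N%:R + 37) * (L / 2) by lra.
by rewrite ler_wpM2l // mulr_ge0 // addr_ge0 // mulr_ge0.
Qed.

End Supermultiplicativity.

(** * Growth rates *)

Section Fekete.
Import numFieldNormedType.Exports.
Context {R : realType}.

Lemma bernoulli (x : R) n : 0 <= x -> 1 + n%:R * x <= (1 + x) ^+ n.
Proof.
move=> x0; elim: n => [|n IH]; first by rewrite mul0r addr0 expr0.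
rewrite exprS -natr1; apply: le_trans (ler_wpM2l _ IH); last by rewrite addr_ge0.
have : 0 <= n%:R * x * x by rewrite !mulr_ge0.
by lra.
Qed.

Lemma exprn_unbounded (a C : R) : 1 < a ->
  exists n0, forall n, (n0 <= n)%N -> C < a ^+ n.
Proof.
move=> a1; pose x := a - 1; have x0 : 0 < x by rewrite subr_gt0.
have aE : a = 1 + x by rewrite /x subrKC.
exists (Num.truncn (`|C| / x)).+1 => n nn.
rewrite aE; apply: lt_le_trans (bernoulli n (ltW x0)).
have : `|C| < n%:R * x.
  rewrite -ltr_pdivrMr //; apply: lt_le_trans (truncnS_gt _) _.
  by rewrite ler_nat.
by have := ler_norm C; lra.
Qed.

(* Compare a^(2k) = (a^k)^2 with the square of the Bernoulli bound. *)
Lemma exprn_gt_linear (a D : R) : 1 < a -> 0 <= D ->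
  exists2 m, (0 < m)%N & D * m.+1%:R < a ^+ m.
Proof.
move=> a1 D0; pose x := a - 1; have x0 : 0 < x by rewrite subr_gt0.
pose k := (Num.truncn (3 * D / (x * x))).+1.
exists (k * 2)%N; first by rewrite muln_gt0.
have kx : 3 * D < k%:R * (x * x).
  by rewrite -ltr_pdivrMr ?mulr_gt0 //; exact: truncnS_gt.
have k1 : 1 <= k%:R :> R by rewrite ler1n.
have aE : a = 1 + x by rewrite /x subrKC.
have := bernoulli k (ltW x0); rewrite -aE => B.
have B2 : (1 + k%:R * x) ^+ 2 <= (a ^+ k) ^+ 2.
  rewrite lerXn2r // nnegrE; first by rewrite addr_ge0 // mulr_ge0 // ltW.
  by rewrite exprn_ge0 //; lra.
rewrite exprM; apply: lt_le_trans B2.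
have -> : (k * 2).+1%:R = 2 * k%:R + 1 :> R by rewrite -natr1 natrM mulrC.
have : 3 * D * k%:R < k%:R * (x * x) * k%:R by rewrite ltr_pM2r //; lra.
have : 0 <= k%:R * x by rewrite mulr_ge0 // ltW.
have : D * 1 <= D * k%:R by rewrite ler_wpM2l.
rewrite expr2; lra.
Qed.

Context (b : nat -> nat).
Hypothesis b0 : b 0 = 1%N.
Hypothesis b_gt0 : forall n, (0 < b n)%N.
Hypothesis b_sub : forall m n, (b (m + n) <= b m * b n)%N.

Let root n : R := (b n)%:R `^ n%:R^-1.

Lemma root_ge1 n : 1 <= root n.
Proof.
rewrite /root -[leLHS](powRr0 (b n)%:R); apply: ler_powR; rewrite ?ler1n //.
Qed.

Lemma rootX n : (0 < n)%N -> root n ^+ n = (b n)%:R.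
Proof.
move=> n0; rewrite /root -powR_mulrn ?powR_ge0 // -powRrM mulVf ?powRr1 //.
by rewrite pnatr_eq0 -lt0n.
Qed.

Let e : R := inf [set root n | n in [set n | (0 < n)%N]].

Lemma root_inf : has_inf [set root n | n in [set n | (0 < n)%N]].
Proof.
split; first by exists (root 1), 1%N.
by exists 1 => _ [n _ <-]; exact: root_ge1.
Qed.

Lemma inf_root_le n : (0 < n)%N -> e <= root n.
Proof. by move=> n0; apply: (ge_inf root_inf.2); exists n. Qed.

Lemma submultiplicative_bound m q s : (b (q * m + s) <= b m ^ q * b 1 ^ s)%N.
Proof.
elim: q => [|q IH].
  rewrite mul0n add0n expn0 mul1n; elim: s => [|s IH]; first by rewrite b0.
  by apply: leq_trans (b_sub 1 s) _; rewrite expnS leq_mul2l IH orbT.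
rewrite mulSn -addnA expnS -mulnA; apply: leq_trans (b_sub _ _) _.
by rewrite leq_mul2l IH orbT.
Qed.

Lemma root_bound m n : (0 < m)%N -> (b n)%:R <= (b 1 ^ m)%:R * root m ^+ n.
Proof.
move=> m0; rewrite {1}(divn_eq n m).
have := submultiplicative_bound m (n %/ m) (n %% m).
rewrite -(ler_nat R) => /le_trans; apply; rewrite natrM mulrC.
have r1 := root_ge1 m.
apply: ler_pM => //.
  rewrite ler_nat; apply: leq_pexp2l => //.
  by rewrite ltnW // ltn_pmod.
rewrite natrX -rootX // -exprM; apply: ler_weXn2l => //.
by rewrite mulnC leq_trunc_div.
Qed.

Lemma root_lt t : e < t -> exists n0, forall n, (n0 <= n)%N -> root n < t.
Proof.
move=> et; have te : 0 < t - e by rewrite subr_gt0.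
have [_ [m m0 <-]] := inf_adherent te root_inf; rewrite subrKC => rt.
have r1 := root_ge1 m; have rp : 0 < root m by lra.
have trm : 1 < t / root m by rewrite ltr_pdivlMr // mul1r.
have [n1 hn1] := exprn_unbounded (b 1 ^ m)%:R trm.
exists (maxn n1 1) => n; rewrite geq_max => /andP[n1n n0].
rewrite -(ltr_pXn2r n0) ?nnegrE ?powR_ge0 //; last by lra.
rewrite rootX //; apply: le_lt_trans (root_bound n m0) _.
by rewrite -ltr_pdivlMr ?exprn_gt0 // -expr_div_n; exact: hn1.
Qed.

Lemma root_lim : limn root = e.
Proof.
apply/cvg_lim => //; apply/cvgrPdist_lt => eps eps0.
have [n0 hn0] : exists n0, forall n, (n0 <= n)%N -> root n < e + eps.
  by apply: root_lt; lra.
exists (maxn n0 1) => // n /=; rewrite geq_max => /andP[n0n n1].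
by rewrite ltr_norml; have := hn0 n n0n; have := inf_root_le n1; lra.
Qed.

Lemma root_lim_ge1 : 1 <= limn root.
Proof.
rewrite root_lim; apply: lb_le_inf; first by have [] := root_inf.
by move=> _ [n _ <-]; exact: root_ge1.
Qed.

Lemma root_limX_le n : limn root ^+ n <= (b n)%:R.
Proof.
case: n => [|n]; first by rewrite expr0 b0.
rewrite -(rootX (ltn0Sn n)) lerXn2r ?nnegrE ?powR_ge0 //.
  by have := root_lim_ge1; lra.
by rewrite root_lim; exact: inf_root_le.
Qed.

Lemma le_root_limX (theta : R) p : (0 < p)%N -> 0 <= theta ->
  (forall k, theta ^+ k <= (b (k * p)%N)%:R) -> theta <= limn root ^+ p.
Proof.
move=> p0 theta0 hk; rewrite leNgt; apply/negP => lt.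
pose rho := theta `^ p%:R^-1.
have rhoX : rho ^+ p = theta.
  by rewrite /rho -powR_mulrn ?powR_ge0 // -powRrM mulVf ?powRr1 // pnatr_eq0 -lt0n.
have rho0 : 0 <= rho by exact: powR_ge0.
have e1 := root_lim_ge1.
have : limn root < rho.
  by rewrite -(ltr_pXn2r p0) ?nnegrE ?rhoX //; lra.
rewrite root_lim => /root_lt[n0 hn0].
pose n := (n0.+1 * p)%N.
have n0n : (n0 <= n)%N by rewrite (leq_trans (leqnSn n0)) // leq_pmulr.
have n_gt0 : (0 < n)%N by rewrite muln_gt0.
have : root n ^+ n < rho ^+ n.
  by rewrite ltr_pXn2r ?nnegrE ?powR_ge0 //; exact: hn0.
rewrite rootX // {2}/n mulnC exprM rhoX.
by rewrite ltNge hk.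
Qed.

End Fekete.

Section GrowthRate.
Context {R : realType} {G : groupType} (S : set G).
Hypothesis genS : finite_generating_set S.

Lemma ball_finite n : finite_set (word_ball S n).
Proof. by case: genS => Sfin _ _; exact: word_ball_finite. Qed.

Lemma ncard_ball0 : ncard (word_ball S 0) = 1%N.
Proof.
have -> : word_ball S 0 = [set 1%g].
  apply/seteqP; split=> [_ [w [w0 _] <-]|_ ->]; last exact: word_ball_one.
  by move: w0; rewrite leqn0 size_eq0 => /eqP ->; rewrite big_nil.
by rewrite /ncard fset_set1 cardfs1.
Qed.

Lemma ncard_ball_gt0 n : (0 < ncard (word_ball S n))%N.
Proof.
rewrite -ncard_ball0; apply: ncard_sub; first exact: ball_finite.
by move=> g; exact: word_ball_sub.
Qed.

Lemma ncard_ball_sub m n :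
  (ncard (word_ball S (m + n)) <= ncard (word_ball S m) * ncard (word_ball S n))%N.
Proof.
rewrite -ncard_setX; try exact: ball_finite.
have : forall g, exists p : G * G, word_ball S (m + n) g ->
    [/\ word_ball S m p.1, word_ball S n p.2 & g = (p.1 * p.2)%g].
  move=> g; have [/word_ball_split[h [k [? ? ?]]]|no] := pselect (word_ball S (m + n) g).
    by exists (h, k).
  by exists (1%g, 1%g).
move=> /choice[f hf].
apply: (@ncard_inj _ _ _ _ f).
- by apply: finite_setX; exact: ball_finite.
- move=> g h; rewrite !inE => /hf[_ _ ge] /hf[_ _ he] fgh.
  by rewrite ge he fgh.
- by move=> g /hf[].
- exact: ball_finite.
Qed.

Lemma growth_rate_ge1 : 1 <= growth_rate R S.
Proof. exact: (root_lim_ge1 ncard_ball0 ncard_ball_gt0 ncard_ball_sub). Qed.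

Lemma growth_rateX_le n : growth_rate R S ^+ n <= (ncard (word_ball S n))%:R.
Proof. exact: (root_limX_le ncard_ball0 ncard_ball_gt0 ncard_ball_sub). Qed.

Lemma ball_le_growth_rateX (C c m : nat) : (0 < m)%N ->
  (forall n, (ncard (word_ball S m) * ncard (word_ball S n) <=
     C * m.+1 * ncard (word_ball S (m + n + c)))%N) ->
  (ncard (word_ball S m))%:R <= (C * m.+1)%:R * growth_rate R S ^+ (m + c).
Proof.
move=> m0 hC.
have C0 : (0 < C * m.+1)%N.
  rewrite lt0n; apply/eqP => C0; have := hC 0%N.
  by rewrite C0 mul0n leqn0 muln_eq0 !eqn0Ngt !ncard_ball_gt0.
have C0' : 0 < (C * m.+1)%:R :> R by rewrite ltr0n.
rewrite mulrC -ler_pdivrMr //.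
apply: (le_root_limX ncard_ball0 ncard_ball_gt0 ncard_ball_sub).
- by rewrite addn_gt0 m0.
- by rewrite divr_ge0.
elim=> [|k IH]; first by rewrite expr0 mul0n ncard_ball0.
have -> : (k.+1 * (m + c) = m + k * (m + c) + c)%N by rewrite mulSn addnAC.
have le := hC (k * (m + c))%N.
rewrite -(ler_nat R) natrM (natrM R (C * m.+1)) in le.
rewrite exprS mulrAC ler_pdivrMr // [leRHS]mulrC.
by apply: le_trans le; exact: ler_wpM2l.
Qed.

End GrowthRate.

Section Words.
Context {G : groupType} (l : nat).
Implicit Types (f : 'I_l -> G).

Definition word_eval f (w : seq 'I_l) : G := (\prod_(i <- w) f i)%g.

Definition letter_eval f (a : 'I_l * bool) : G :=
  (if a.2 then (f a.1)^-1 else f a.1)%g.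

Lemma reduced_word_exists (w : seq ('I_l * bool)) :
  exists t : free_group l, forall f,
    free_group_eval f t = (\prod_(a <- w) letter_eval f a)%g.
Proof.
elim: w => [|a w [[t tred] ht]].
  by exists (exist _ [::] isT) => f; rewrite /free_group_eval !big_nil.
case: t tred ht => [|b t] tred ht.
  exists (exist _ [:: a] isT) => f.
  by rewrite [RHS]big_cons -ht /free_group_eval /= big_cons.
have [/andP[/eqP ab1 ab2]|ab] := boolP ((a.1 == b.1) && (a.2 != b.2)).
  have tred' : reduced_word t := path_sorted tred.
  exists (exist _ t tred') => f; rewrite [RHS]big_cons -ht /free_group_eval /= big_cons.
  rewrite /letter_eval ab1; case: (a.2) (b.2) ab2 => -[] // _.
    by rewrite mulKg.
  by rewrite mulVKg.
have tred' : reduced_word (a :: b :: t) by apply/andP.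
exists (exist _ (a :: b :: t) tred') => f.
by rewrite [RHS]big_cons -ht /free_group_eval /= !big_cons.
Qed.

Lemma equation_exists (w w' : seq 'I_l) : exists t : free_group l, forall f,
  free_group_eval f t = 1%g <-> word_eval f w = word_eval f w'.
Proof.
have [t ht] := reduced_word_exists
  ([seq (i, false) | i <- w] ++ [seq (i, true) | i <- rev w']).
exists t => f; rewrite ht big_cat !big_map /letter_eval /=.
rewrite -/(word_eval f w) prodgV revK -/(word_eval f w').
by split=> [/divg1_eq|->] //; rewrite mulgV.
Qed.

Lemma word_ball_eval (S : set G) f m : (range f = word_ball S 1) ->
  word_ball S m = [set word_eval f w | w in [set w : seq 'I_l | size w = m]].
Proof.
move=> fS; elim: m => [|m IH].
  apply/seteqP; split=> [_ [w [w0 _] <-]|_ [w /= /size0nil -> <-]].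
    exists [::] => //; move: w0; rewrite leqn0 size_eq0 => /eqP ->.
    by rewrite /word_eval !big_nil.
  by rewrite /word_eval big_nil; exact: word_ball_one.
apply/seteqP; split=> [g|_ [[|i w] //= [wm] <-]].
  rewrite -[m.+1]add1n => /word_ball_split[h [k [+ + ->]]].
  rewrite -fS IH => -[i _ <-] [w /= wm <-].
  by exists (i :: w); rewrite /= ?wm // /word_eval big_cons.
rewrite /word_eval big_cons -[m.+1]add1n; apply: word_ballM.
  by rewrite -fS; exists i.
by rewrite IH; exists w.
Qed.

Lemma ball_enumeration (S : set G) : finite_set S -> (ncard (word_ball S 1) <= l)%N ->
  exists f, range f = word_ball S 1.
Proof.
move=> Sfin le.
have Bfin : finite_set (word_ball S 1) by exact: word_ball_finite.
exists (fun i => nth 1%g (fset_set (word_ball S 1)) i).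
have one : 1%g \in fset_set (word_ball S 1).
  by rewrite in_fset_set // inE; exact: word_ball_one.
apply/seteqP; split=> [_ [i _ <-]|g Sg].
  have [lt|ge] := ltnP i (size (fset_set (word_ball S 1))).
    by have := mem_nth 1%g lt; rewrite in_fset_set // inE.
  by rewrite nth_default //; exact: word_ball_one.
have gS : g \in fset_set (word_ball S 1) by rewrite in_fset_set // inE.
have lt : (index g (fset_set (word_ball S 1)) < l)%N.
  by apply: leq_trans le; rewrite index_mem.
by exists (Ordinal lt) => //=; rewrite nth_index.
Qed.

End Words.

(** * Limits of generating sets *)

Section UltraLimit.
Context {G : groupType} (l : nat) (U : set_system (set G)) (f : set G -> 'I_l -> G).
Hypothesis UU : UltraFilter U.
Hypothesis l_gt0 : (0 < l)%N.
Hypothesis noeth : equationally_noetherian G.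

(* By equational Noetherianity almost every marked group S satisfies all the
   relations of the ultralimit of the marked groups. *)
Lemma ultra_limit_relations : U [set S | forall w w' : seq 'I_l,
  U [set S' | word_eval (f S') w = word_eval (f S') w'] ->
  word_eval (f S) w = word_eval (f S) w'].
Proof.
pose Sigma := [set t : free_group l | U [set S | free_group_eval (f S) t = 1%g]].
have [Sigma0 [fin0 sub0 sol0]] := noeth Sigma l_gt0.
have U0 : U [set S | solution_set Sigma0 (f S)].
  have := @filter_bigI _ _ (fset_set Sigma0)
    (fun t => [set S | free_group_eval (f S) t = 1%g]) U _.
  move=> /(_ _) H; apply: filterS (H _).
    by move=> S hS t Sigma0t; apply: hS; rewrite /= in_fset_set // inE.
  by move=> t; rewrite in_fset_set // inE => /sub0.
apply: filterS U0 => S; rewrite sol0 => hS w w' Uww'.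
have {}hS t : Sigma t -> free_group_eval (f S) t = 1%g by move=> /hS.
have [t ht] := @equation_exists G l w w'.
have [+ _] := ht (f S); apply; apply: hS; rewrite /Sigma /=.
by apply: filterS Uww' => S' /= e; have [_ +] := ht (f S'); apply.
Qed.

Lemma ultra_limit_ball (S0 : set G) m (P : set (set G)) : U P ->
  (forall S, P S -> range (f S) = word_ball S 1) ->
  (forall S, P S -> finite_set S) ->
  range (f S0) = word_ball S0 1 -> finite_set S0 ->
  (forall w w' : seq 'I_l,
    U [set S' | word_eval (f S') w = word_eval (f S') w'] ->
    word_eval (f S0) w = word_eval (f S0) w') ->
  exists2 S, P S & (ncard (word_ball S0 m) <= ncard (word_ball S m))%N.
Proof.
move=> UP Pf Pfin f0 fin0 limit.
have Uinj : U [set S | forall p : m.-tuple 'I_l * m.-tuple 'I_l,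
    word_eval (f S) p.1 = word_eval (f S) p.2 ->
    word_eval (f S0) p.1 = word_eval (f S0) p.2].
  apply: filter_forall => p.
  have [Ueq|Uneq] := in_ultra_setVsetC
    [set S | word_eval (f S) p.1 = word_eval (f S) p.2] UU.
    by apply: filterS UP => S _ _; exact: limit.
  by apply: filterS Uneq => S /= ne /ne.
have [S [PS inj]] := filter_ex (filterI UP Uinj).
exists S => //.
have : forall g, exists w : m.-tuple 'I_l, word_ball S0 m g -> word_eval (f S0) w = g.
  move=> g; rewrite (word_ball_eval m f0).
  have [[w /= wm <-]|no] := pselect ([set word_eval (f S0) w |
      w in [set w : seq 'I_l | size w = m]] g).
    by exists (Tuple (introT eqP wm)).
  by exists (nseq_tuple m (Ordinal l_gt0)).
move=> /choice[wd hwd].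
apply: (ncard_inj (f := fun g => word_eval (f S) (wd g))).
- by apply: word_ball_finite; exact: Pfin.
- move=> g h; rewrite !inE => /hwd ge /hwd he eq.
  by rewrite -ge -he; exact: (inj (wd g, wd h)).
- move=> g _; rewrite (word_ball_eval m (Pf S PS)).
  by exists (wd g) => //=; rewrite size_tuple.
- exact: word_ball_finite.
Qed.

End UltraLimit.

Theorem theorem1p1 (R : realType) (G : groupType) (X : metricType R)
    (delta : R) (to : G -> X -> X) :
  finitely_generated G ->
  hyperbolic_space X delta ->
  isometric_action to ->
  acylindrical to ->
  ~ elementary to ->
  (exists M : nat, forall S : set G, finite_generating_set S ->
     exists g : G, word_ball S M g /\ hyperbolic_element to g) ->
  equationally_noetherian G ->
  wo_chain <=%R [in growth_rates R G].
Proof.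
move=> fgG hypX actX acylX nonelem hypM noeth.
have [C [c supermult]] :=
  ball_supermultiplicative fgG hypX actX acylX nonelem hypM.
apply: antisymmetric_wo_chain => [x y _ _|A sAC [t0 At0]]; first exact: le_anti.
apply: contrapT => nomin.
have below t : t \in A -> exists2 t', t' \in A & t' < t.
  move=> At; apply: contrapT => no; apply: nomin; exists t; split=> // t' At'.
  by rewrite leNgt; apply/negP => lt; apply: no; exists t'.
have rate t : t \in A -> exists2 S : set G, finite_generating_set S & growth_rate R S = t.
  by move=> /sAC; rewrite inE => -[S genS <-]; exists S.
pose base t := [set S : set G | finite_generating_set S /\
  (growth_rate R S \in A) /\ growth_rate R S <= t].
have baseF : ProperFilter (filter_from [set t | t \in A] base).
  apply: filter_from_proper => [|t At]; last first.
    by have [S genS eS] := rate t At; exists S; rewrite /base /= eS.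
  apply: filter_from_filter; first by exists t0.
  move=> t t' At At'; exists (Num.min t t').
    by rewrite /= minEle; case: ifP.
  move=> S [genS [AS]]; rewrite le_min => /andP[St St'].
  by split; split.
have [U [UU baseU]] := ultraFilterLemma baseF.
have Ubase t : t \in A -> U (base t) by move=> At; apply: baseU; exists t.
have bound (S : set G) m : finite_generating_set S -> (0 < m)%N ->
    (ncard (word_ball S m))%:R <= (C * m.+1)%:R * growth_rate R S ^+ (m + c).
  by move=> genS m0; apply: ball_le_growth_rateX => // n; exact: supermult.
pose l := (Num.truncn ((C * 2)%:R * t0 ^+ (1 + c))).+1.
have : forall S : set G, exists f : 'I_l -> G, base t0 S -> range f = word_ball S 1.
  move=> S; have [[genS [_ St0]]|no] := pselect (base t0 S); last by exists (fun=> 1%g).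
  have [f hf] : exists f : 'I_l -> G, range f = word_ball S 1; last by exists f.
  apply: ball_enumeration; first by case: genS.
  rewrite -(ler_nat R); apply: le_trans (ltW (truncnS_gt _)).
  apply: le_trans (bound S 1%N genS isT) _; apply: ler_wpM2l => //.
  have e0 : 0 <= growth_rate R S by apply: le_trans (growth_rate_ge1 genS).
  have t00 : 0 <= t0 by exact: le_trans St0.
  by apply: lerXn2r.
move=> /choice[f hf].
have := filter_ex (filterI (Ubase t0 At0)
  (ultra_limit_relations f UU isT noeth)).
move=> [S0 [S0base limit]].
have [gen0 [A0 le0]] := S0base.
have [t1 At1 lt1] := below _ A0.
have main m : (0 < m)%N ->
    growth_rate R S0 ^+ m <= (C * m.+1)%:R * t1 ^+ (m + c).
  move=> m0.
  have UP : U (base t0 `&` base t1) by apply: filterI; exact: Ubase.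
  have Pf S : (base t0 `&` base t1) S -> range (f S) = word_ball S 1.
    by move=> [/hf].
  have Pfin S : (base t0 `&` base t1) S -> finite_set S by move=> [[[]]].
  have fin0 : finite_set S0 by case: gen0.
  have [S [_ [genS [_ le1]]] le] :=
    ultra_limit_ball UU (isT : (0 < l)%N) m UP Pf Pfin (hf S0 S0base) fin0 limit.
  apply: le_trans (growth_rateX_le (R := R) gen0 m) _.
  apply: (@le_trans _ _ (ncard (word_ball S m))%:R); first by rewrite ler_nat.
  apply: le_trans (bound S m genS m0) _; apply: ler_wpM2l => //.
  have e0 : 0 <= growth_rate R S by apply: le_trans (growth_rate_ge1 genS).
  have t10 : 0 <= t1 by exact: le_trans le1.
  by apply: lerXn2r.
have [S1 gen1 e1] := rate t1 At1.
have t1_ge1 : 1 <= t1 by rewrite -e1; exact: growth_rate_ge1.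
have t1_gt0 : 0 < t1 by exact: lt_le_trans t1_ge1.
have ratio : 1 < growth_rate R S0 / t1 by rewrite ltr_pdivlMr // mul1r.
have D0 : 0 <= C%:R * t1 ^+ c by rewrite mulr_ge0 // exprn_ge0 // ltW.
have [m m0] := exprn_gt_linear ratio D0.
rewrite expr_div_n ltr_pdivlMr ?exprn_gt0 // ltNge => /negP; apply.
apply: le_trans (main m m0) _; rewrite natrM exprD.
by rewrite le_eqVlt; apply/orP; left; apply/eqP; ring.
Qed.
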